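(* Let $\mathbb{H}$ be a real or complex Hilbert space, let $A\in\mathbb{B}(\mathbb{H})$ be a nonzero positive operator, and let $T\in\mathbb{B}_{A^{1/2}}(\mathbb{H})$ with $\|T\|_A\neq 0$. Let $\widetilde{T}\in\mathbb{B}(\mathbf{R}(A^{1/2}))$ be the unique bounded operator on the Hilbert space $\mathbf{R}(A^{1/2})$ satisfying $\widetilde{T}Ax=ATx$ for all $x\in\mathbb{H}$. Then $T$ is $A$-smooth if and only if $\widetilde{T}$ is a smooth point of the normed space $\mathbb{B}(\mathbf{R}(A^{1/2}))$ (with the operator norm).
   Context: $\mathbb{B}(\mathbb{K})$ denotes the bounded linear operators on a Hilbert space $\mathbb{K}$. A positive operator $A$ is a self-adjoint operator with $\langle Ax,x\rangle\ge 0$ for all $x$. It induces the semi-inner product $\langle x,y\rangle_A=\langle Ax,y\rangle$ and the semi-norm $\|x\|_A=\sqrt{\langle x,x\rangle_A}=\|A^{1/2}x\|$. $\mathbb{B}_{A^{1/2}}(\mathbb{H})$ is the set of $A$-bounded operators, i.e. those $T\in\mathbb{B}(\mathbb{H})$ for which there is $c>0$ with $\|Tx\|_A\le c\|x\|_A$ for all $x\in\mathbb{H}$; for such $T$, $\|T\|_A=\sup\{\|Tx\|_A:\|x\|_A=1\}$. $T\perp_A^B S$ means $\|T+\lambda S\|_A\ge\|T\|_A$ for all scalars $\lambda$. An operator $T\in\mathbb{B}_{A^{1/2}}(\mathbb{H})$ with $\|T\|_A\neq 0$ is called $A$-smooth if for all $S_1,S_2\in\mathbb{B}_{A^{1/2}}(\mathbb{H})$,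 $T\perp_A^B S_1$ and $T\perp_A^B S_2$ imply $T\perp_A^B S_1+S_2$. The Hilbert space $\mathbf{R}(A^{1/2})$ is the range $R(A^{1/2})$ with the inner product $\langle A^{1/2}x,A^{1/2}y\rangle_{\mathbf{R}(A^{1/2})}=\langle Px,Py\rangle$ for $x,y\in\mathbb{H}$, where $P$ is the orthogonal projection of $\mathbb{H}$ onto $\overline{R(A)}$; $R(A)$ is dense in it, $\|Ax\|_{\mathbf{R}(A^{1/2})}=\|x\|_A$, and it is known that for each $T\in\mathbb{B}_{A^{1/2}}(\mathbb{H})$ the operator $\widetilde{T}$ exists, is unique, and has operator norm $\|T\|_A$. A nonzero element of a normed space is smooth if it admits a unique supporting functional (norm-one functional $f$ with $f(v)=\|v\|$); equivalently, Birkhoff–James orthogonality ($v\perp_B w$ iff $\|v+\lambda w\|\ge\|v\|$ for all scalars $\lambda$) is right additive at it. *)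

(* Defs.v *)
From HB Require Import structures.
From mathcomp Require Import all_boot all_order all_algebra sesquilinear complex.
From mathcomp Require Import all_classical all_reals topology normedtype.

Set Implicit Arguments.
Unset Strict Implicit.
Unset Printing Implicit Defensive.

Import Order.TTheory GRing.Theory Num.Theory.
Import numFieldNormedType.Exports.

Local Open Scope classical_set_scope.
Local Open Scope ring_scope.

Variant scalar_kind := RealScalars | ComplexScalars.

Definition scalar_field (R : realType) (k : scalar_kind) : numFieldType :=
  match k with RealScalars => R | ComplexScalars => R[i] end.

Definition scalar_conj (R : realType) (k : scalar_kind) :
    scalar_field R k -> scalar_field R k :=
  match k with
  | RealScalars => fun a : R => a
  | ComplexScalars => fun a : R[i] => conjc a
  end.

Definition scalar_re (R : realType) (k : scalar_kind) : scalar_field R k -> R :=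
  match k with
  | RealScalars => fun a : R => a
  | ComplexScalars => fun a : R[i] => complex.Re a
  end.

Definition scalar_of_real (R : realType) (k : scalar_kind) :
    R -> scalar_field R k :=
  match k with
  | RealScalars => fun r : R => r
  | ComplexScalars => fun r : R => real_complex R r
  end.

(* Norms of a normed module and absolute values take their values in the scalar
   field; suprema and square roots are taken in [R], through [scalar_re].       *)

Section Seminorms.
Variables (R : realType) (k : scalar_kind) (E : lmodType (scalar_field R k)).
Implicit Types (n : E -> R) (U : E -> E).

Definition form_norm (f : E -> E -> scalar_field R k) (x : E) : R :=
  Num.sqrt (scalar_re (f x x)).

Definition op_bounded n U := exists2 c : R, 0 < c & forall x, n (U x) <= c * n x.

Definition op_norm n U : R := sup [set n (U x) | x in [set x | n x = 1]].

Definition bounded_ops n : set (E -> E) := [set U | linear U /\ op_bounded n U].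

Definition bj_orthogonal (N : E -> R) (v w : E) :=
  forall l : scalar_field R k, N v <= N (v + l *: w).

(* The normed space is the subspace [D] of [E], with norm [N]. A functional on
   it is represented by a function on [E] of which only the values on [D]
   matter.                                                                    *)
Definition supporting (D : set E) (N : E -> R) (v : E)
    (f : E -> scalar_field R k) :=
  [/\ forall a x y, D x -> D y -> f (a *: x + y) = a * f x + f y,
      exists c : R, forall x, D x -> scalar_re `|f x| <= c * N x,
      sup [set scalar_re `|f x| | x in D `&` [set x | N x = 1]] = 1
    & f v = scalar_of_real k (N v)].

Definition smooth_point (D : set E) (N : E -> R) (v : E) :=
  [/\ D v, v <> 0 &
      exists2 f, supporting D N v f &
        forall g, supporting D N v g -> forall x, D x -> g x = f x].

End Seminorms.

Section RangeSpace.
Variables (K : numFieldType) (H : lmodType K) (S : {linear H -> H}).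

Definition in_range : {pred H} := fun y => y \in range S.

Record range_space := RangeSpace { rs_val : H; _ : rs_val \in in_range }.

Lemma in_range_submod_closed : submod_closed in_range.
Proof.
split=> [|a u v]; rewrite !unfold_in /in_range ?inE.
  by exists 0; rewrite // linear0.
by move=> [x _ <-] [y _ <-]; exists (a *: x + y); rewrite // linearP.
Qed.

HB.instance Definition _ := GRing.isSubmodClosed.Build K H in_range
  in_range_submod_closed.
HB.instance Definition _ := [isSub for rs_val].
HB.instance Definition _ := [Choice of range_space by <:].
HB.instance Definition _ := [SubChoice_isSubLmodule of range_space by <:].

End RangeSpace.

Section Hilbert.
Variables (R : realType) (k : scalar_kind).
Variables (H : completeNormedModType (scalar_field R k)).
Variable (ip : {dot H for @scalar_conj R k}).
Implicit Types A T S : {linear H -> H}.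

Definition positive_operator A :=
  [/\ op_bounded (form_norm ip) A,
      forall x y, ip (A x) y = ip x (A y)
    & forall x, 0 <= ip (A x) x].

Definition positive_sqrt A S := positive_operator S /\ forall x, S (S x) = A x.

Definition orthogonal_projection (M : set H) (P : H -> H) :=
  forall x, M (P x) /\ forall y, M y -> ip (x - P x) y = 0.

Definition ipA A (x y : H) := ip (A x) y.

Definition normA A : H -> R := form_norm (ipA A).

Definition op_normA A : (H -> H) -> R := op_norm (normA A).

Definition A_bounded A T :=
  op_bounded (form_norm ip) T /\ op_bounded (normA A) T.

Definition A_smooth A T :=
  [/\ A_bounded A T, op_normA A T <> 0 &
      forall S1 S2 : {linear H -> H}, A_bounded A S1 -> A_bounded A S2 ->
        bj_orthogonal (op_normA A) T S1 -> bj_orthogonal (op_normA A) T S2 ->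
        bj_orthogonal (op_normA A) T (S1 \+ S2)].

(* With [S] the positive square root of [A] and [P] the orthogonal projection
   onto the closure of the range of [A], [P] vanishes on [ker S = ker A], so
   [range_ip] does not depend on the preimages chosen.                        *)
Definition range_ip S (P : H -> H) (u v : range_space S) : scalar_field R k :=
  let preim u := xget 0 [set x | S x = rs_val u] in
  ip (P (preim u)) (P (preim v)).

Definition range_norm S (P : H -> H) : range_space S -> R :=
  form_norm (range_ip P (S := S)).

End Hilbert.

(* Main.v *)
Require Import Defs.
From HB Require Import structures.
From mathcomp Require Import all_boot all_order all_algebra sesquilinear complex.
From mathcomp Require Import all_classical all_reals topology normedtype.
From mathcomp Require Import ring lra.

(** Write [b] for a semi-inner product, [n] for its semi-norm, [M] for the norm
    of an operator [T].  The proof replaces both notions of smoothness by one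
    geometric condition, [aligned_maximizers]: two unit vectors that nearly
    maximize [n (T x)] nearly agree up to a scalar of modulus one.

    If the maximizers are aligned, [b (S x) (T x)] has a limit along the nearly
    maximizing [x], and its real part is [M] times the derivative of the
    operator norm at [T] in the direction [S] ([op_norm_perturb]).  Hence there
    is just one supporting functional ([aligned_smooth]), and orthogonality of
    [T] to [S] means that the functional vanishes at [S], which is an additive
    condition ([aligned_bj_additive]).

    Conversely, the ultralimit of [b (S x) (T x) / M] along any maximizing
    sequence is a supporting functional ([max_functional_supporting]).  If
    these all coincide, or if orthogonality is additive at [T], the limit
    cannot depend on the sequence.  Nearly maximizing vectors are almost fixed
    by [T^* T / M^2], so for every admissible [S] the real part of [b (S x) x]
    converges along them ([smooth_cauchy_at_max], [additive_cauchy_at_max]).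

    The core is that this convergence for few operators [S] forces alignment
    ([positive_aligned_maximizers]).  Two families suffice: the operators [Q A]
    with [Q] bounded and symmetric, and the positive contractions commuting with
    [A^(1/2)].  Both consist of [A]-bounded operators on [H] that also act
    boundedly on [R(A^(1/2))], so they serve the two sides of the equivalence
    alike.  If the overlap of the nearly maximizing vectors with some fixed
    vector does not tend to zero, they are aligned ([aligned_of_overlap]).
    Otherwise they tend weakly to zero, and a gliding hump ([gliding_hump])
    yields an operator [S] for which [b (S x) x] oscillates: a projection, in
    the form [Q A], if [A x] does not tend to zero ([no_mass_off_zero]), and a
    limit of polynomials in [A] if it does ([mass_off_zero]).

    Finally [x |-> A x] is an isometry of [H], with the semi-norm of [A], onto a
    dense subspace of [R(A^(1/2))]; it intertwines [T] with the given operator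
    on that space, so that alignment passes from one to the other
    ([aligned_maximizers_inj]). *)

Import Order.TTheory GRing.Theory Num.Theory.
Import numFieldNormedType.Exports.
Local Open Scope classical_set_scope.
Local Open Scope ring_scope.

Set Implicit Arguments.
Unset Strict Implicit.
Unset Printing Implicit Defensive.

(** * Real and complex scalars *)

Section Scalars.
Variables (R : realType) (k : scalar_kind).
Local Notation K := (scalar_field R k).
Local Notation re := (@scalar_re R k).
Local Notation cj := (@scalar_conj R k).
Local Notation oR := (@scalar_of_real R k).
Implicit Types (a b : K) (r s : R).

Definition sabs a : R := re `|a|.

Lemma scalar_reD a b : re (a + b) = re a + re b.
Proof. by case: k a b => //= -[? ?] [? ?]. Qed.

Lemma scalar_reN a : re (- a) = - re a.
Proof. by case: k a => //= -[? ?]. Qed.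

Lemma scalar_re0 : re 0 = 0.
Proof. by case: k. Qed.

Lemma scalar_re_real r : re (oR r) = r.
Proof. by case: k. Qed.

Lemma scalar_re_realM r a : re (oR r * a) = r * re a.
Proof. by case: k a => //= -[? ?] /=; rewrite mul0r subr0. Qed.

Lemma scalar_realD r s : oR (r + s) = oR r + oR s.
Proof. by case: k => //=; rewrite rmorphD. Qed.

Lemma scalar_realN r : oR (- r) = - oR r.
Proof. by case: k => //=; rewrite rmorphN. Qed.

Lemma scalar_realM r s : oR (r * s) = oR r * oR s.
Proof. by case: k => //=; rewrite rmorphM. Qed.

Lemma scalar_real1 : oR 1 = 1.
Proof. by case: k. Qed.

Lemma scalar_real0 : oR 0 = 0.
Proof. by case: k. Qed.

Lemma scalar_realV r : oR r^-1 = (oR r)^-1.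
Proof. by case: k => //=; rewrite fmorphV. Qed.

Lemma scalar_real_eq0 r : (oR r == 0) = (r == 0).
Proof. by case: k => //=; rewrite fmorph_eq0. Qed.

Lemma scalar_real_ge0 r : (0 <= oR r) = (0 <= r).
Proof. by case: k => //=; rewrite ler0c. Qed.

Lemma scalar_real_gt0 r : (0 < oR r) = (0 < r).
Proof. by rewrite !lt0r scalar_real_eq0 scalar_real_ge0. Qed.

Lemma scalar_conjD a b : cj (a + b) = cj a + cj b.
Proof. by case: k a b => //= a b; rewrite rmorphD. Qed.

Lemma scalar_conjM a b : cj (a * b) = cj a * cj b.
Proof. by case: k a b => //= a b; rewrite rmorphM. Qed.

Lemma scalar_conjN a : cj (- a) = - cj a.
Proof. by case: k a => //= a; rewrite rmorphN. Qed.

Lemma scalar_conj0 : cj 0 = 0.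
Proof. by case: k => //=; apply: (conjc_real (0 : R)). Qed.

Lemma scalar_conj_real r : cj (oR r) = oR r.
Proof. by case: k => //=; apply: conjc_real. Qed.

Lemma scalar_re_conj a : re (cj a) = re a.
Proof. by case: k a => //= -[]. Qed.

Lemma scalar_ge0_re a : 0 <= a -> 0 <= re a.
Proof. by case: k a => //= a; rewrite lecE => /andP[]. Qed.

Lemma scalar_ge0_real a : 0 <= a -> a = oR (re a).
Proof.
case: k a => [//|] /= [x y]; rewrite lecE /= => /andP[/eqP -> _].
by [].
Qed.

Lemma scalar_norm a : `|a| = oR (sabs a).
Proof. exact: scalar_ge0_real. Qed.

Lemma sabs_ge0 a : 0 <= sabs a.
Proof. exact/scalar_ge0_re. Qed.

Lemma sabsM a b : sabs (a * b) = sabs a * sabs b.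
Proof. by rewrite {1}/sabs normrM scalar_norm scalar_re_realM. Qed.

Lemma sabsN a : sabs (- a) = sabs a.
Proof. by rewrite /sabs normrN. Qed.

Lemma sabsBC a b : sabs (a - b) = sabs (b - a).
Proof. by rewrite -sabsN opprB. Qed.

Lemma sabs_real r : sabs (oR r) = `|r|.
Proof.
rewrite /sabs; case: k => //=.
by rewrite expr0n addr0 sqrtr_sqr.
Qed.

Lemma sabs0 : sabs 0 = 0.
Proof. by rewrite /sabs normr0 scalar_re0. Qed.

Lemma sabs1 : sabs 1 = 1.
Proof. by rewrite -scalar_real1 sabs_real normr1. Qed.

Lemma sabs_eq0 a : sabs a = 0 -> a = 0.
Proof.
by move=> h; apply/eqP; rewrite -normr_eq0 scalar_norm h scalar_real0.
Qed.

Lemma sabsD a b : sabs (a + b) <= sabs a + sabs b.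
Proof.
have := ler_normD a b; rewrite -subr_ge0 => /scalar_ge0_re.
by rewrite !scalar_reD scalar_reN subr_ge0.
Qed.

Lemma sabs_conj a : sabs (cj a) = sabs a.
Proof. by rewrite /sabs; case: k a => //= -[x y] /=; rewrite sqrrN. Qed.

Lemma scalar_mul_conj a : a * cj a = oR (sabs a ^+ 2).
Proof.
rewrite /sabs; case: k a => /= [a|[x y]]; first by rewrite real_normK ?num_real.
rewrite /= sqr_sqrtr ?addr_ge0 ?sqr_ge0 //.
by apply/eqP; rewrite eq_complex /=; apply/andP; split; apply/eqP; ring.
Qed.

Lemma scalar_re_le_sabs a : re a <= sabs a.
Proof.
rewrite /sabs; case: k a => /= [a|[x y]]; first exact: ler_norm.
rewrite /=; apply: le_trans (ler_norm _) _.
by rewrite -sqrtr_sqr ler_sqrt ?addr_ge0 ?sqr_ge0 // lerDl sqr_ge0.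
Qed.

Lemma scalar_re_norm_sabs a : `|re a| <= sabs a.
Proof.
by rewrite ler_norml scalar_re_le_sabs andbT lerNl -scalar_reN -sabsN
  scalar_re_le_sabs.
Qed.

Lemma scalar_phase a : exists2 c : K, sabs c = 1 & c * a = oR (sabs a).
Proof.
have [->|a0] := eqVneq a 0.
  by exists 1; rewrite ?sabs1 // sabs0 mulr0 scalar_real0.
exists (`|a| / a); last by rewrite divfK // scalar_norm.
rewrite /sabs normrM normfV normr_id divff ?normr_eq0 //.
by rewrite -scalar_real1 scalar_re_real.
Qed.

(** Closed intervals are compact, and the imaginary part, if there is one, is
    treated like the real part. *)
Lemma bounded_ultra_lim (I : Type) (W : set_system I) (u : I -> K) (c : R) :
  UltraFilter W -> (forall i, sabs (u i) <= c) ->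
  exists l : K, forall e : R, 0 < e -> W [set i | sabs (u i - l) < e].
Proof.
move=> UW.
have real_lim (v : I -> R) : (forall i, `|v i| <= c) ->
    exists l : R, forall e : R, 0 < e -> W [set i | `|v i - l| < e].
  move=> vc.
  have := @segment_compact R (- c) c; rewrite compact_ultra.
  have UVW : UltraFilter (v @ W).
    split=> [|G PG WG]; first exact: fmap_proper_filter.
    rewrite predeqE => A; split=> [GA|]; last exact: WG.
    have [//|WnA] := @in_ultra_setVsetC _ W (v @^-1` A) UW.
    have /WG GnA : (v @ W) (~` A) by [].
    have : G set0 by rewrite -(setICr A); exact: filterI.
    by move/(@filter_not_empty _ _ PG).
  move=> /(_ (v @ W) UVW) [].
    by apply: (@filterE _ W) => i; rewrite /= in_itv /= -ler_norml vc.
  move=> l [_ vl]; exists l => e e0.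
  have := vl _ (@nbhsx_ballx _ _ l e e0); apply: (@filterS _ W) => i /=.
  by rewrite /ball /= distrC.
rewrite /sabs; case: k u => /= u uc; first exact: real_lim.
have normE (z : R[i]) :
    `|complex.Re z| <= complex.Re `|z| /\ `|complex.Im z| <= complex.Re `|z|.
  case: z => x y; rewrite /= -!sqrtr_sqr.
  by rewrite !ler_sqrt ?addr_ge0 ?sqr_ge0 // lerDl lerDr !sqr_ge0.
have [i|lr lrP] := real_lim (fun i => complex.Re (u i)).
  exact: le_trans (normE (u i)).1 (uc i).
have [i|li liP] := real_lim (fun i => complex.Im (u i)).
  exact: le_trans (normE (u i)).2 (uc i).
exists (Complex lr li) => e e0.
have e2 : 0 < e / 2 by rewrite divr_gt0.
have : W ([set i | `|complex.Re (u i) - lr| < e / 2] `&`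
          [set i | `|complex.Im (u i) - li| < e / 2]).
  by apply: filterI; [exact: lrP|exact: liP].
apply: (@filterS _ W) => i /= [].
case: (u i) => x y /= hx hy.
have hx2 : (x - lr) ^+ 2 < (e / 2) ^+ 2.
  by rewrite -(real_normK (num_real (x - lr))) ltr_pXn2r ?nnegrE // ltW.
have hy2 : (y - li) ^+ 2 < (e / 2) ^+ 2.
  by rewrite -(real_normK (num_real (y - li))) ltr_pXn2r ?nnegrE // ltW.
rewrite -(ger0_norm (ltW e0)) -sqrtr_sqr ltr_sqrt; last by rewrite exprn_gt0.
have -> : e ^+ 2 = (e / 2) ^+ 2 + (e / 2) ^+ 2 + e ^+ 2 / 2 by field.
have : 0 < e ^+ 2 by rewrite exprn_gt0.
by lra.
Qed.

End Scalars.

(** * Semi-inner products and operator semi-norms *)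

Section SemiInner.
Variables (R : realType) (k : scalar_kind).
Local Notation K := (scalar_field R k).
Local Notation re := (@scalar_re R k).
Local Notation cj := (@scalar_conj R k).
Local Notation oR := (@scalar_of_real R k).

Definition semi_inner (E : lmodType K) (b : E -> E -> K) :=
  [/\ forall a x y z, b (a *: x + y) z = a * b x z + b y z,
      forall x y, b y x = cj (b x y)
    & forall x, 0 <= re (b x x)].

Section Form.
Variables (E : lmodType K) (b : E -> E -> K) (hb : semi_inner b).
Local Notation n := (form_norm b).
Implicit Types (x y z : E) (a c : K).

Lemma formDl x y z : b (x + y) z = b x z + b y z.
Proof. by case: hb => h _ _; have := h 1 x y z; rewrite scale1r mul1r. Qed.

Lemma form0l z : b 0 z = 0.
Proof.
have := formDl 0 0 z; rewrite addr0 => /eqP.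
by rewrite -subr_eq0 opprD addNKr oppr_eq0 => /eqP.
Qed.

Lemma formZl a x z : b (a *: x) z = a * b x z.
Proof. by case: hb => h _ _; have := h a x 0 z; rewrite addr0 form0l addr0. Qed.

Lemma formC x y : b y x = cj (b x y).
Proof. by case: hb. Qed.

Lemma formDr x y z : b z (x + y) = b z x + b z y.
Proof. by rewrite formC formDl scalar_conjD -!formC. Qed.

Lemma form0r z : b z 0 = 0.
Proof. by rewrite formC form0l scalar_conj0. Qed.

Lemma formZr a x z : b z (a *: x) = cj a * b z x.
Proof. by rewrite formC formZl scalar_conjM -formC. Qed.

Lemma formNl x z : b (- x) z = - b x z.
Proof. by rewrite -scaleN1r formZl mulN1r. Qed.

Lemma formNr x z : b z (- x) = - b z x.
Proof. by rewrite formC formNl scalar_conjN -formC. Qed.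

Lemma formBl x y z : b (x - y) z = b x z - b y z.
Proof. by rewrite formDl formNl. Qed.

Lemma formBr x y z : b z (x - y) = b z x - b z y.
Proof. by rewrite formDr formNr. Qed.

Lemma re_formC x y : re (b x y) = re (b y x).
Proof. by rewrite formC scalar_re_conj. Qed.

Lemma form_norm_ge0 x : 0 <= n x.
Proof. exact: sqrtr_ge0. Qed.

Lemma sqr_form_norm x : n x ^+ 2 = re (b x x).
Proof. by rewrite sqr_sqrtr //; case: hb. Qed.

Lemma form_self x : b x x = oR (n x ^+ 2).
Proof.
rewrite sqr_form_norm; have := formC x x.
case: k E b x => //= F f x; case: (f x x) => u v [/eqP].
by rewrite -addr_eq0 -mulr2n mulrn_eq0 /= => /eqP ->.
Qed.

Lemma sqr_form_normD x y : n (x + y) ^+ 2 = n x ^+ 2 + n y ^+ 2 + 2 * re (b x y).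
Proof.
rewrite !sqr_form_norm formDl !formDr !scalar_reD (re_formC y x).
by ring.
Qed.

Lemma form_normZ a x : n (a *: x) = sabs a * n x.
Proof.
apply/eqP; rewrite -(eqrXn2 (n := 2)) ?mulr_ge0 ?form_norm_ge0 ?sabs_ge0 //.
rewrite sqr_form_norm formZl formZr mulrA scalar_mul_conj scalar_re_realM.
by rewrite -sqr_form_norm exprMn.
Qed.

Lemma form_normZr (r : R) x : 0 <= r -> n (oR r *: x) = r * n x.
Proof. by move=> r0; rewrite form_normZ sabs_real ger0_norm. Qed.

Lemma form_normN x : n (- x) = n x.
Proof. by rewrite -scaleN1r form_normZ sabsN sabs1 mul1r. Qed.

Lemma form_norm0 : n 0 = 0.
Proof. by rewrite -(scale0r 0) form_normZ sabs0 mul0r. Qed.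

Lemma form_normBC x y : n (x - y) = n (y - x).
Proof. by rewrite -form_normN opprB. Qed.

Lemma sqr_form_normB x y : n (x - y) ^+ 2 = n x ^+ 2 + n y ^+ 2 - 2 * re (b x y).
Proof. by rewrite sqr_form_normD form_normN formNr scalar_reN mulrN. Qed.

Lemma form_parallelogram x y :
  n (x + y) ^+ 2 + n (x - y) ^+ 2 = 2 * n x ^+ 2 + 2 * n y ^+ 2.
Proof. by rewrite sqr_form_normD sqr_form_normB; ring. Qed.

Lemma re_form_le x y : re (b x y) <= n x * n y.
Proof.
set p := re (b x y).
have key (t : R) : 0 <= n x ^+ 2 - 2 * t * p + t ^+ 2 * n y ^+ 2.
  have := sqr_ge0 (n (x - oR t *: y)).
  rewrite sqr_form_normB form_normZ sabs_real exprMn real_normK ?num_real //.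
  by rewrite formZr scalar_conj_real scalar_re_realM -/p; lra.
have nx := form_norm_ge0 x; have ny := form_norm_ge0 y.
have [p0|p0] := lerP p 0; first exact: le_trans p0 (mulr_ge0 nx ny).
have [y0|y0] := eqVneq (n y) 0.
  have := key ((n x ^+ 2 + 1) / p).
  rewrite y0 expr0n /= mulr0 addr0 -mulrA divfK ?gt_eqF //.
  by have := sqr_ge0 (n x); lra.
rewrite -(@ler_pXn2r _ 2) ?nnegrE ?mulr_ge0 // ?(ltW p0) //.
have := key (p / n y ^+ 2).
have y2 : n y ^+ 2 != 0 by rewrite sqrf_eq0.
have -> : n x ^+ 2 - 2 * (p / n y ^+ 2) * p + (p / n y ^+ 2) ^+ 2 * n y ^+ 2 =
  (n x ^+ 2 * n y ^+ 2 - p ^+ 2) / n y ^+ 2 by field.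
by rewrite pmulr_lge0 ?invr_gt0 ?exprn_gt0 ?lt0r ?y0 // subr_ge0 exprMn.
Qed.

Lemma form_cauchy_schwarz x y : sabs (b x y) <= n x * n y.
Proof.
have [c c1 cE] := scalar_phase (b x y).
have := re_form_le (c *: x) y.
by rewrite formZl cE scalar_re_real form_normZ c1 mul1r.
Qed.

Lemma form_normD x y : n (x + y) <= n x + n y.
Proof.
rewrite -(@ler_pXn2r _ 2) ?nnegrE ?addr_ge0 ?form_norm_ge0 //.
by rewrite sqr_form_normD sqrrD; have := re_form_le x y; lra.
Qed.

Lemma form_norm_triangle x y : n x - n y <= n (x - y).
Proof. by rewrite lerBlDr; have := form_normD (x - y) y; rewrite subrK. Qed.

End Form.

Section OpNorm.
Variables (E : lmodType K) (b : E -> E -> K) (hb : semi_inner b).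
Local Notation n := (form_norm b).
Local Notation N := (op_norm n).
Implicit Types (x y : E) (U : E -> E).

Lemma form_norm_normalize x : n x != 0 -> n (oR (n x)^-1 *: x) = 1.
Proof.
by move=> x0; rewrite form_normZr ?invr_ge0 ?form_norm_ge0 // mulVf.
Qed.

Lemma linear_applyZ (F : lmodType K) (U : E -> F) : linear U ->
  forall a x, U (a *: x) = a *: U x.
Proof.
move=> lU a x; have U0 : U 0 = 0.
  have := lU 1 0 0; rewrite !scale1r addr0 => /eqP.
  by rewrite -subr_eq0 opprD addNKr oppr_eq0 => /eqP.
by have := lU a x 0; rewrite U0 !addr0.
Qed.

Lemma linear_applyD (F : lmodType K) (U : E -> F) : linear U ->
  forall x y, U (x + y) = U x + U y.
Proof. by move=> lU x y; have := lU 1 x y; rewrite !scale1r. Qed.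

Lemma linear_applyB (F : lmodType K) (U : E -> F) : linear U ->
  forall x y, U (x - y) = U x - U y.
Proof.
by move=> lU x y; rewrite (linear_applyD lU) -scaleN1r (linear_applyZ lU) scaleN1r.
Qed.

Lemma op_norm_has_ubound U : op_bounded n U ->
  has_ubound [set n (U x) | x in [set x | n x = 1]].
Proof.
by case=> c _ Uc; exists c => _ [x /= x1 <-]; have := Uc x; rewrite x1 mulr1.
Qed.

Lemma op_norm_ge0 U : 0 <= N U.
Proof.
rewrite /op_norm; set V := [set n (U x) | x in [set x | n x = 1]].
have [[u uS]|S0] := pselect (V !=set0).
  have [hs|/sup_out -> //] := pselect (has_sup V).
  apply: le_trans (sup_upper_bound hs uS).
  by case: uS => x _ <-; exact: form_norm_ge0.
by rewrite sup_out // => -[].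
Qed.

Lemma op_norm_le U x : linear U -> op_bounded n U -> n (U x) <= N U * n x.
Proof.
move=> lU bU; have [x0|x0] := eqVneq (n x) 0.
  by case: bU => c _ /(_ x); rewrite x0 !mulr0.
have : n (U (oR (n x)^-1 *: x)) <= N U.
  apply: ub_le_sup; first exact: op_norm_has_ubound.
  by exists (oR (n x)^-1 *: x) => //=; rewrite form_norm_normalize.
rewrite (linear_applyZ lU) form_normZr ?invr_ge0 ?form_norm_ge0 //.
by rewrite mulrC ler_pdivrMr // lt0r x0 form_norm_ge0.
Qed.

Lemma op_norm_lub U c : 0 <= c -> (forall x, n x = 1 -> n (U x) <= c) -> N U <= c.
Proof.
move=> c0 Uc; rewrite /op_norm.
have [S0|S0] := pselect ([set n (U x) | x in [set x | n x = 1]] !=set0).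
  by apply: ge_sup => // _ [x /= x1 <-]; exact: Uc.
by rewrite sup_out // => -[].
Qed.

End OpNorm.
End SemiInner.

(** * Ultralimits of scalar sequences *)

Section UltraLimit.
Variables (R : realType) (k : scalar_kind).
Local Notation K := (scalar_field R k).
Variables (W : set_system nat) (UW : UltraFilter W).
Implicit Types (u v : nat -> K) (l : K).

Lemma ultraI (A B : set nat) : W A -> W B -> W (A `&` B).
Proof. exact: filterI. Qed.

Lemma ultra_ex (A : set nat) : W A -> exists i, A i.
Proof. exact: filter_ex. Qed.

Definition ultra_cvg u l := forall e : R, 0 < e -> W [set i | sabs (u i - l) < e].

Definition ultra_lim u : K := xget 0 [set l | ultra_cvg u l].

Lemma ultra_cvg_unique u l l' : ultra_cvg u l -> ultra_cvg u l' -> l = l'.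
Proof.
move=> ul ul'; apply/eqP; rewrite -subr_eq0; apply/eqP/sabs_eq0/eqP.
rewrite eq_le sabs_ge0 andbT leNgt; apply/negP => d0.
have d2 : 0 < sabs (l - l') / 2 by rewrite divr_gt0.
have : W ([set i | sabs (u i - l) < sabs (l - l') / 2] `&`
          [set i | sabs (u i - l') < sabs (l - l') / 2]).
  by apply: filterI; [exact: ul|exact: ul'].
move/(@filter_ex _ W _) => [i [/= h1 h2]].
have := sabsD (l - u i) (u i - l'); rewrite addrA subrK (sabsBC l (u i)).
by move: h1 h2; lra.
Qed.

Lemma ultra_limE u l : ultra_cvg u l -> ultra_lim u = l.
Proof.
move=> ul; apply: (@ultra_cvg_unique u) => //.
by apply: (@xgetPex _ 0 [set l | ultra_cvg u l]); exists l.
Qed.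

Lemma ultra_lim_cvg u c : (forall i, sabs (u i) <= c) -> ultra_cvg u (ultra_lim u).
Proof.
move=> uc; have [l ul] := bounded_ultra_lim UW uc.
by rewrite (ultra_limE ul).
Qed.

Lemma ultra_cvgD a u v l l' :
  ultra_cvg u l -> ultra_cvg v l' -> ultra_cvg (fun i => a * u i + v i) (a * l + l').
Proof.
move=> ul vl e e0; pose c := sabs a + 1.
have c0 : 0 < c by rewrite /c; have := sabs_ge0 a; lra.
have ec : 0 < e / (2 * c) by rewrite divr_gt0 ?mulr_gt0.
have e2 : 0 < e / 2 by rewrite divr_gt0.
apply: (filterS _ (filterI (ul _ ec) (vl _ e2))) => i [/= h1 h2].
have -> : a * u i + v i - (a * l + l') = a * (u i - l) + (v i - l') by ring.
apply: le_lt_trans (sabsD _ _) _; rewrite sabsM.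
have : sabs a * sabs (u i - l) <= c * (e / (2 * c)).
  by rewrite ler_pM ?sabs_ge0 // /c ?lerDl // ltW.
have -> : c * (e / (2 * c)) = e / 2 by field; rewrite gt_eqF.
by move: h2; lra.
Qed.

Lemma ultra_cvg_le u l c : ultra_cvg u l -> (forall i, sabs (u i) <= c) -> sabs l <= c.
Proof.
move=> ul uc; apply/ler_addgt0Pr => e e0.
have [i /= h] := @filter_ex _ W _ _ (ul _ e0).
have := sabsD (l - u i) (u i); rewrite subrK (sabsBC l).
by have := uc i; lra.
Qed.

End UltraLimit.

Lemma free_ultrafilter : exists W : set_system nat,
  UltraFilter W /\ forall N : nat, W [set i | (N <= i)%N].
Proof.
have [W [UW sW]] := @ultraFilterLemma nat eventually _.
by exists W; split=> // N; apply: sW; exists N.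
Qed.

(** * Near-maximizing vectors *)

Section NearMax.
Variables (R : realType) (k : scalar_kind).
Local Notation K := (scalar_field R k).
Local Notation re := (@scalar_re R k).
Local Notation oR := (@scalar_of_real R k).
Variables (E : lmodType K) (b : E -> E -> K) (hb : semi_inner b).
Local Notation n := (form_norm b).
Local Notation N := (op_norm n).
Local Notation D := (bounded_ops n).

Definition near_max (T : E -> E) (d : R) : set E :=
  [set x | n x = 1 /\ N T - d < n (T x)].

(** Near-maximizing unit vectors are close up to a scalar of modulus one; the
    condition on [T] that both kinds of smoothness amount to. *)
Definition aligned_maximizers T := forall e : R, 0 < e -> exists2 d : R, 0 < d &
  forall x y, near_max T d x -> near_max T d y -> 1 - e <= sabs (b x y).

(** Convergence of the quadratic form of [S] along the near-maximizing vectors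
    of [T], stated by Cauchy's criterion so as not to name the limit. *)
Definition cauchy_at_max T S := forall e : R, 0 < e -> exists2 d : R, 0 < d &
  forall x y, near_max T d x -> near_max T d y ->
    re (b (S x) x) - re (b (S y) y) <= e.

Lemma near_max_sub T d d' : d <= d' -> near_max T d `<=` near_max T d'.
Proof. by move=> dd x [x1 xd]; split=> //; lra. Qed.

Lemma bounded_opsP a U V : D U -> D V -> D (a *: U + V).
Proof.
move=> [lU [c c0 cU]] [lV [c' c'0 cV]]; split.
  move=> l x y; rewrite /= !fctE lU lV !scalerDr !scalerA (mulrC a l).
  by rewrite addrACA.
have c1 : 0 < sabs a * c + c' by rewrite ltr_wpDl ?mulr_ge0 ?sabs_ge0 ?ltW.
exists (sabs a * c + c') => // x.
apply: le_trans (form_normD hb _ _) _; rewrite (form_normZ hb) mulrDl -mulrA.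
by rewrite lerD // ler_wpM2l ?sabs_ge0.
Qed.

Lemma bounded_ops0 : D 0.
Proof.
split=> [a y z|]; first by rewrite -[RHS]/(a *: 0 + 0) scaler0 addr0.
by exists 1 => // y; rewrite -[_ y]/(0 : E) (form_norm0 hb) mul1r form_norm_ge0.
Qed.

Lemma bounded_opsZ a U : D U -> D (a *: U).
Proof. by move=> DU; have := bounded_opsP a DU bounded_ops0; rewrite addr0. Qed.

Lemma bounded_op_unit V x : D V -> n x = 1 -> n (V x) <= N V.
Proof.
by move=> DV x1; have := op_norm_le hb x DV.1 DV.2; rewrite x1 mulr1.
Qed.

Lemma op_norm_normalize U : D U -> N U != 0 -> N (oR (N U)^-1 *: U) = 1.
Proof.
move=> DU U0; have U1 : 0 < N U by rewrite lt0r U0 op_norm_ge0.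
have U1E x : n ((oR (N U)^-1 *: U) x) = (N U)^-1 * n (U x).
  by rewrite -[X in n X]/(oR (N U)^-1 *: U x) (form_normZr hb) // invr_ge0 ltW.
apply/eqP; rewrite eq_le; apply/andP; split.
  apply: (op_norm_lub (E := E)) => // y y1.
  by rewrite U1E mulrC ler_pdivrMr // mul1r bounded_op_unit.
rewrite -(ler_pM2l U1) mulr1; apply: (op_norm_lub (E := E)).
  by rewrite mulr_ge0 ?op_norm_ge0 ?ltW.
move=> y y1; have := bounded_op_unit (bounded_opsZ (oR (N U)^-1) DU) y1.
by rewrite U1E mulrC ler_pdivrMr // mulrC.
Qed.

Lemma bounded_ops_comp U V : D U -> D V -> D (U \o V).
Proof.
move=> [lU [c c0 cU]] [lV [c' c'0 cV]]; split; first by move=> l x y /=; rewrite lV lU.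
exists (c * c'); first exact: mulr_gt0.
by move=> x /=; apply: le_trans (cU _) _; rewrite -mulrA ler_pM2l.
Qed.

Variables (T : E -> E) (DT : D T) (NT0 : N T != 0).
Local Notation M := (N T).

Lemma op_norm_gt0 : 0 < M.
Proof. by rewrite lt0r NT0 op_norm_ge0. Qed.
Let M0 := op_norm_gt0.

Lemma near_max_ex d : 0 < d -> exists x, near_max T d x.
Proof.
move=> d0.
have [hs|] := pselect (has_sup [set n (T x) | x in [set x | n x = 1]]).
  by have [_ [x x1 <-] xd] := sup_adherent d0 hs; exists x.
by move/sup_out; rewrite -/(op_norm n T) => h; have := NT0; rewrite h eqxx.
Qed.

Lemma near_max_le x : n x = 1 -> n (T x) <= M.
Proof.
by move=> x1; have := op_norm_le hb x DT.1 DT.2; rewrite x1 mulr1.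
Qed.

(** The defect form is positive because [M] bounds [T], and nearly vanishes at
    near-maximizing vectors; Cauchy-Schwarz for it then replaces the adjoint of
    [T]: near-maximizing vectors are almost eigenvectors of [T^* T]. *)
Definition defect_form x y : K := oR (M ^+ 2) * b x y - b (T x) (T y).

Lemma defect_form_semi_inner : semi_inner defect_form.
Proof.
split=> [a x y z|x y|x]; rewrite /defect_form.
- by rewrite DT.1 !(formDl hb) !(formZl hb); ring.
- rewrite scalar_conjD scalar_conjN scalar_conjM scalar_conj_real.
  by rewrite -!(formC hb).
rewrite scalar_reD scalar_reN scalar_re_realM -!(sqr_form_norm hb) subr_ge0.
rewrite -exprMn ler_pXn2r ?nnegrE ?mulr_ge0 ?form_norm_ge0 ?(ltW M0) //.
exact: (op_norm_le hb x DT.1 DT.2).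
Qed.

Lemma sqr_defect_norm x :
  form_norm defect_form x ^+ 2 = M ^+ 2 * n x ^+ 2 - n (T x) ^+ 2.
Proof.
rewrite (sqr_form_norm defect_form_semi_inner) scalar_reD scalar_reN.
by rewrite scalar_re_realM -!(sqr_form_norm hb).
Qed.

Lemma sqr_defect_near_max d x : d <= M -> near_max T d x ->
  form_norm defect_form x ^+ 2 <= 2 * M * d.
Proof.
move=> dM [x1 xd]; rewrite sqr_defect_norm x1 expr1n mulr1.
have : (M - d) ^+ 2 <= n (T x) ^+ 2.
  by rewrite ler_pXn2r ?nnegrE ?form_norm_ge0 ?subr_ge0 // ltW.
rewrite sqrrB; have := sqr_ge0 d; set m := M; rewrite -mulr_natl; lra.
Qed.

(** [S x] and [x] are paired by the defect form, which is small at [x]. *)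
Lemma form_at_max S e : D S -> 0 < e -> exists2 d : R, 0 < d &
  forall x, near_max T d x ->
    sabs (b (T (S x)) (T x) - oR (M ^+ 2) * b (S x) x) <= e.
Proof.
move=> DS e0; pose B := N S + 1.
have B0 : 0 < B by rewrite ltr_wpDl ?op_norm_ge0.
have c0 : 0 < 2 * M ^+ 3 * B ^+ 2 by rewrite !mulr_gt0 ?exprn_gt0.
exists (Num.min M (e ^+ 2 / (2 * M ^+ 3 * B ^+ 2))).
  by rewrite lt_min M0 divr_gt0 ?exprn_gt0.
move=> x xd; rewrite sabsBC -/(defect_form (S x) x).
apply: le_trans (form_cauchy_schwarz defect_form_semi_inner _ _) _.
rewrite -(@ler_pXn2r _ 2) ?nnegrE ?mulr_ge0 ?form_norm_ge0 ?(ltW e0) // exprMn.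
have SB : form_norm defect_form (S x) ^+ 2 <= M ^+ 2 * B ^+ 2.
  rewrite sqr_defect_norm lerBlDr.
  apply: le_trans (_ : M ^+ 2 * B ^+ 2 + 0 <= _); last by rewrite lerD2l sqr_ge0.
  rewrite addr0 ler_wpM2l ?sqr_ge0 // ler_pXn2r ?nnegrE ?form_norm_ge0 ?(ltW B0) //.
  by apply: le_trans (bounded_op_unit DS xd.1) _; rewrite lerDl.
have xB := sqr_defect_near_max (_ : Num.min _ _ <= M) xd.
have {}xB := xB ltac:(by rewrite ge_min lexx).
have xB' : form_norm defect_form x ^+ 2 <= 2 * M * (e ^+ 2 / (2 * M ^+ 3 * B ^+ 2)).
  by apply: le_trans xB _; rewrite ler_pM2l ?mulr_gt0 // ge_min lexx orbT.
apply: le_trans (ler_pM _ _ SB xB') _; rewrite ?sqr_ge0 //.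
by rewrite le_eqVlt; apply/orP; left; apply/eqP; field; rewrite !gt_eqF.
Qed.

(** One-sided differentiability of the operator norm at [T]: away from the
    near-maximizing vectors a small perturbation cannot reach the norm, and at
    them the first-order term is the form at [U x] and [T x]. *)
Lemma op_norm_perturb U s d e : D U -> 0 < d -> 0 < e ->
  (forall x, near_max T d x -> re (b (U x) (T x)) <= s) ->
  exists2 r : R, 0 < r &
    forall x, n x = 1 -> n (T x + oR r *: U x) ^+ 2 <= M ^+ 2 + 2 * r * (s + e).
Proof.
move=> DU d0 e0 Us; pose B := N U; have B0 : 0 <= B by exact: op_norm_ge0.
pose d1 := Num.min d M.
have d10 : 0 < d1 by rewrite lt_min d0.
have d1M : d1 <= M by rewrite ge_min lexx orbT.
pose c := 2 * M * B + B ^+ 2 + 2 * `|s| + 1.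
have c0 : 0 < c.
  by rewrite /c ltr_wpDl // !addr_ge0 // ?mulr_ge0 ?sqr_ge0 ?(ltW M0).
pose r := Num.min (2 * e / (B ^+ 2 + 1)) (Num.min 1 (d1 * M / c)).
have B1 : 0 < B ^+ 2 + 1 by rewrite ltr_wpDl ?sqr_ge0.
have r0 : 0 < r by rewrite !lt_min ltr01 !divr_gt0 ?mulr_gt0.
have rB : r * B ^+ 2 <= 2 * e.
  have : r * (B ^+ 2 + 1) <= 2 * e by rewrite -ler_pdivlMr // ge_min lexx.
  by rewrite mulrDr mulr1; lra.
have r1 : r <= 1 by rewrite !ge_min lexx /= orbT.
have rc : r * c <= d1 * M by rewrite -ler_pdivlMr // !ge_min lexx !orbT.
exists r => // x x1; rewrite (sqr_form_normD hb) (form_normZr hb) ?(ltW r0) //.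
rewrite (formZr hb) scalar_conj_real scalar_re_realM (re_formC hb) exprMn.
have UB := bounded_op_unit DU x1.
have TM := near_max_le x1.
have nU0 := form_norm_ge0 b (U x); have nT0 := form_norm_ge0 b (T x).
have UB2 : n (U x) ^+ 2 <= B ^+ 2 by rewrite ler_pXn2r ?nnegrE.
have rUB : r ^+ 2 * n (U x) ^+ 2 <= r ^+ 2 * B ^+ 2 by rewrite ler_wpM2l ?sqr_ge0.
have [xd|xd] := ltrP (M - d) (n (T x)).
  have h1 := Us x (conj x1 xd).
  have h2 : n (T x) ^+ 2 <= M ^+ 2 by rewrite ler_pXn2r ?nnegrE ?(ltW M0).
  have h3 : r * re (b (U x) (T x)) <= r * s by rewrite ler_pM2l.
  have h4 : r * (r * B ^+ 2) <= r * (2 * e) by rewrite ler_pM2l.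
  by lra.
have h1 : n (T x) <= M - d1.
  by apply: le_trans xd _; rewrite lerB // ge_min lexx.
have h2 : n (T x) ^+ 2 <= (M - d1) ^+ 2 by rewrite ler_pXn2r ?nnegrE ?subr_ge0.
have h3 : d1 * d1 <= d1 * M by rewrite ler_pM2l.
have h4 : re (b (U x) (T x)) <= B * M.
  by apply: le_trans (re_form_le hb _ _) _; rewrite ler_pM.
have h5 : r * re (b (U x) (T x)) <= r * (B * M) by rewrite ler_pM2l.
have h6 : r * (r * B ^+ 2) <= r * (1 * B ^+ 2) by rewrite ler_pM2l // ler_wpM2r ?sqr_ge0.
have h7 : - (r * `|s|) <= r * s by rewrite -mulrN ler_pM2l // lerNl -normrN ler_norm.
have h8 : 0 <= r * e by rewrite mulr_ge0 ?ltW.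
by move: h2 rc; rewrite /c; lra.
Qed.

(** [b (S x) (T x)] does not change when [x] is multiplied by a scalar of modulus
    one, so it is nearly constant on nearly parallel vectors. *)
Lemma aligned_form_cauchy S e : aligned_maximizers T -> D S -> 0 < e ->
  exists2 d : R, 0 < d & forall x y, near_max T d x -> near_max T d y ->
    sabs (b (S x) (T x) - b (S y) (T y)) <= e.
Proof.
move=> al DS e0; pose B := N S + 1.
have B0 : 0 < B by rewrite ltr_wpDl ?op_norm_ge0.
have c0 : 0 < 2 * B * M by rewrite !mulr_gt0.
have e'0 : 0 < (e / (2 * B * M)) ^+ 2 / 2 by rewrite divr_gt0 ?exprn_gt0 ?divr_gt0.
have [d d0 dP] := al _ e'0.
exists d => // x y xd yd; have [c c1 cE] := scalar_phase (b x y).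
have nw : n (c *: x - y) <= e / (2 * B * M).
  rewrite -(@ler_pXn2r _ 2) ?nnegrE ?form_norm_ge0 //; last first.
    by rewrite ltW ?divr_gt0.
  rewrite (sqr_form_normB hb) (form_normZ hb) (formZl hb) cE scalar_re_real c1.
  rewrite xd.1 yd.1; have := dP x y xd yd.
  by move: (e / (2 * B * M)) => q; lra.
set w := c *: x - y in nw.
have -> : b (S x) (T x) - b (S y) (T y) = b (S w) (T (c *: x)) + b (S y) (T w).
  rewrite /w !(linear_applyB DS.1) !(linear_applyB DT.1).
  rewrite !(linear_applyZ DS.1) !(linear_applyZ DT.1) !(formBl hb) !(formBr hb).
  rewrite !(formZl hb) !(formZr hb) !mulrA scalar_mul_conj c1 expr1n.
  by rewrite scalar_real1; ring.
apply: le_trans (sabsD _ _) _.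
have SB z : n (S z) <= B * n z.
  apply: le_trans (op_norm_le hb z DS.1 DS.2) _.
  by rewrite ler_wpM2r ?form_norm_ge0 // lerDl.
have TB z : n (T z) <= M * n z by exact: (op_norm_le hb z DT.1 DT.2).
have h1 : sabs (b (S w) (T (c *: x))) <= B * n w * M.
  apply: le_trans (form_cauchy_schwarz hb _ _) _.
  rewrite ler_pM ?form_norm_ge0 //; apply: le_trans (TB _) _.
  by rewrite (form_normZ hb) c1 xd.1 !mulr1.
have h2 : sabs (b (S y) (T w)) <= B * (M * n w).
  apply: le_trans (form_cauchy_schwarz hb _ _) _.
  rewrite ler_pM ?form_norm_ge0 //; apply: le_trans (SB _) _.
  by rewrite yd.1 mulr1.
have h3 : 2 * B * M * n w <= e by rewrite mulrC -ler_pdivlMr.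
by lra.
Qed.

End NearMax.

(** * Supporting functionals as ultralimits *)

Section Supporting.
Variables (R : realType) (k : scalar_kind).
Local Notation K := (scalar_field R k).
Local Notation oR := (@scalar_of_real R k).
Variables (E : lmodType K) (b : E -> E -> K) (hb : semi_inner b).
Local Notation n := (form_norm b).
Local Notation N := (op_norm n).
Local Notation D := (bounded_ops n).
Variables (T : E -> E) (DT : D T) (NT0 : N T != 0).
Local Notation M := (N T).
Let M0 : 0 < M := op_norm_gt0 NT0.

Definition maximizing_seq (x : nat -> E) :=
  forall i, near_max b T (i.+1%:R^-1) (x i).

Lemma maximizing_seq_ex : exists x, maximizing_seq x.
Proof.
have /choice[x xP] (i : nat) : exists y, near_max b T (i.+1%:R^-1) y.
  by apply: near_max_ex; rewrite ?invr_gt0.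
by exists x.
Qed.

Lemma exists_small_inv (d : R) : 0 < d -> exists m : nat, forall i,
  (m <= i)%N -> i.+1%:R^-1 <= d.
Proof.
move=> d0; exists (Num.bound d^-1) => i mi.
rewrite -[leRHS]invrK lef_pV2 ?posrE ?invr_gt0 //.
apply: le_trans (ltW (archi_boundP _)) _; first by rewrite invr_ge0 ltW.
by rewrite ler_nat leqW.
Qed.

Section Functional.
Variables (W : set_system nat) (UW : UltraFilter W).
Hypothesis freeW : forall m : nat, W [set i | (m <= i)%N].
Variables (x : nat -> E) (xT : maximizing_seq x).

Definition max_functional (S : E -> E) : K :=
  oR M^-1 * ultra_lim W (fun i => b (S (x i)) (T (x i))).

Lemma near_max_eventually d : 0 < d -> W [set i | near_max b T d (x i)].
Proof.
move=> d0; have [m mP] := exists_small_inv d0.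
apply: (filterS _ (freeW m)) => i /= /mP mi.
exact: near_max_sub mi _ (xT i).
Qed.

Lemma max_functional_bound S i : D S -> sabs (b (S (x i)) (T (x i))) <= N S * M.
Proof.
move=> DS; apply: le_trans (form_cauchy_schwarz hb _ _) _.
have x1 : n (x i) = 1 by case: (xT i).
by rewrite ler_pM ?form_norm_ge0 // (bounded_op_unit hb).
Qed.

Lemma max_functional_cvg S : D S ->
  ultra_cvg W (fun i => b (S (x i)) (T (x i))) (oR M * max_functional S).
Proof.
move=> DS; rewrite /max_functional mulrA -scalar_realM divff //.
rewrite scalar_real1 mul1r.
by apply: (@ultra_lim_cvg _ _ _ UW _ (N S * M)) => i; exact: max_functional_bound.
Qed.

Lemma max_functionalE S l : ultra_cvg W (fun i => b (S (x i)) (T (x i))) l ->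
  max_functional S = oR M^-1 * l.
Proof. by move=> Sl; rewrite /max_functional (ultra_limE UW Sl). Qed.

Lemma max_functional_linear a S V : D S -> D V ->
  max_functional (a *: S + V) = a * max_functional S + max_functional V.
Proof.
move=> DS DV.
have := ultra_cvgD UW a (max_functional_cvg DS) (max_functional_cvg DV).
have -> : (fun i => a * b (S (x i)) (T (x i)) + b (V (x i)) (T (x i))) =
          (fun i => b ((a *: S + V) (x i)) (T (x i))).
  by apply/funext => i; rewrite -(formZl hb) -(formDl hb).
move/max_functionalE ->; rewrite scalar_realV mulrDr mulrCA.
by rewrite !mulKf ?scalar_real_eq0.
Qed.

Lemma max_functionalZ a S : D S -> max_functional (a *: S) = a * max_functional S.
Proof.
move=> DS; have D0 := bounded_ops0 hb.
have f0 : max_functional 0 = 0.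
  have := max_functional_linear (-1) D0 D0.
  by rewrite scaler0 addr0 mulN1r addNr.
by have := max_functional_linear a DS D0; rewrite f0 !addr0.
Qed.

Lemma max_functional_self : max_functional T = oR M.
Proof.
rewrite (@max_functionalE T (oR (M ^+ 2))).
  by rewrite -scalar_realM expr2 mulKf.
move=> e e0; have c0 : 0 < e / (2 * M) by rewrite divr_gt0 ?mulr_gt0.
apply: (filterS _ (near_max_eventually c0)) => i /= [x1 xd].
rewrite (form_self hb) -scalar_realN -scalar_realD sabs_real distrC ger0_norm.
  have h0 := form_norm_ge0 b (T (x i)).
  have h1 : n (T (x i)) <= M by exact: near_max_le.
  have h2 : (M - n (T (x i))) * (M + n (T (x i))) < e / (2 * M) * (2 * M).
    apply: le_lt_trans (_ : _ <= (M - n (T (x i))) * (2 * M)) _.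
      by rewrite ler_wpM2l ?subr_ge0 //; lra.
    by rewrite ltr_pM2r ?mulr_gt0 //; lra.
  by move: h2; rewrite divfK ?gt_eqF ?mulr_gt0 //; lra.
by rewrite subr_ge0 ler_pXn2r ?nnegrE ?form_norm_ge0 ?(ltW M0) // near_max_le.
Qed.

Lemma sabs_max_functional S : D S -> sabs (max_functional S) <= N S.
Proof.
move=> DS; have := ultra_cvg_le UW (max_functional_cvg DS).
move=> /(_ (N S * M)) h; have {}h := h (fun i => max_functional_bound i DS).
by move: h; rewrite sabsM sabs_real (gtr0_norm M0) mulrC ler_pM2r.
Qed.

(** Cauchy-Schwarz bounds the functional by the operator norm, and the bound is
    attained at [T] because [n (T (x i))] tends to the norm of [T]. *)
Lemma max_functional_supporting : supporting D N T max_functional.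
Proof.
split.
- by move=> a S V; exact: max_functional_linear.
- by exists 1 => S DS; rewrite mul1r -/(sabs _) sabs_max_functional.
- have D1T : D (oR M^-1 *: T) by exact: bounded_opsZ.
  have N1T : N (oR M^-1 *: T) = 1 by exact: op_norm_normalize.
  have f1 : sabs (max_functional (oR M^-1 *: T)) = 1.
    rewrite max_functionalZ // max_functional_self -scalar_realM mulVf //.
    by rewrite scalar_real1 sabs1.
  apply/eqP; rewrite eq_le; apply/andP; split.
    apply: ge_sup; first by exists 1, (oR M^-1 *: T).
    move=> _ [S /= [DS S1] <-]; rewrite -/(sabs _) -S1.
    exact: sabs_max_functional.
  apply: ub_le_sup; last by exists (oR M^-1 *: T).
  by exists 1 => _ [S /= [DS S1] <-]; rewrite -/(sabs _) -S1 sabs_max_functional.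
- exact: max_functional_self.
Qed.

End Functional.
End Supporting.

(** * Aligned maximizers, smoothness and additivity of orthogonality *)

Section Smoothness.
Variables (R : realType) (k : scalar_kind).
Local Notation K := (scalar_field R k).
Local Notation re := (@scalar_re R k).
Local Notation oR := (@scalar_of_real R k).
Variables (E : lmodType K) (b : E -> E -> K) (hb : semi_inner b).
Local Notation n := (form_norm b).
Local Notation N := (op_norm n).
Local Notation D := (bounded_ops n).
Variables (T : E -> E) (DT : D T) (NT0 : N T != 0).
Local Notation M := (N T).
Let M0 : 0 < M := op_norm_gt0 NT0.

Lemma supporting_linearZ g a V : supporting D N T g -> D V -> g (a *: V) = a * g V.
Proof.
move=> [lg _ _ _] DV; have D0 := bounded_ops0 hb.
have g0 : g 0 = 0.
  by have := lg (-1) 0 0 D0 D0; rewrite scaler0 addr0 mulN1r addNr.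
by have := lg a V 0 DV D0; rewrite g0 !addr0.
Qed.

Lemma sabs_supporting_le g V : supporting D N T g -> D V -> sabs (g V) <= N V.
Proof.
move=> sg DV; have gZ := supporting_linearZ _ sg.
case: sg => lg [c gc] g1 gT; have [V0|V0] := eqVneq (N V) 0.
  by have := gc V DV; rewrite V0 mulr0.
have V1 : 0 < N V by rewrite lt0r V0 op_norm_ge0.
have : sabs (g (oR (N V)^-1 *: V)) <= 1.
  rewrite -[leRHS]g1; apply: ub_le_sup.
    by exists c => _ [S /= [DS S1] <-]; rewrite -[c]mulr1 -S1 gc.
  exists (oR (N V)^-1 *: V) => //; split; first exact: bounded_opsZ.
  exact: op_norm_normalize.
rewrite gZ // sabsM sabs_real gtr0_norm ?invr_gt0 // mulrC.
by rewrite ler_pdivrMr // mul1r.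
Qed.

(** The functional keeps the value [N T] on the line through [T] along [V]. *)
Lemma supporting_bj g V :
  supporting D N T g -> D V -> g V = 0 -> bj_orthogonal N T V.
Proof.
move=> sg DV gV l; have DTV : D (T + l *: V).
  by rewrite addrC; exact: bounded_opsP.
have := sabs_supporting_le sg DTV.
case: (sg) => lg _ _ gT; rewrite addrC lg // gV mulr0 add0r gT.
by rewrite sabs_real ger0_norm ?op_norm_ge0 // addrC.
Qed.

(** Two maximizing sequences along which the forms of [S] stay apart have
    ultralimit functionals that differ at [T \o S], since the defect of [T]
    vanishes along both. *)
Lemma not_cauchy_at_max S : D S -> ~ cauchy_at_max b T S ->
  exists g1 g2 : (E -> E) -> K, [/\ supporting D N T g1, supporting D N T g2
    & g1 (T \o S) <> g2 (T \o S)].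
Proof.
move=> DS /existsNP[e /not_implyP[e0 nS]].
have /choice[xy xyP] (i : nat) : exists xy : E * E,
    [/\ near_max b T (i.+1%:R^-1) xy.1, near_max b T (i.+1%:R^-1) xy.2 &
      e < re (b (S xy.1) xy.1) - re (b (S xy.2) xy.2)].
  apply: contrapT => nxy; apply: nS; exists i.+1%:R^-1; first by rewrite invr_gt0.
  move=> x y xd yd; rewrite leNgt; apply/negP => exy; apply: nxy.
  by exists (x, y).
have [W [UW fW]] := free_ultrafilter.
have xT : maximizing_seq b T (fun i => (xy i).1) by move=> i; case: (xyP i).
have yT : maximizing_seq b T (fun i => (xy i).2) by move=> i; case: (xyP i).
exists (max_functional b T W (fun i => (xy i).1)).
exists (max_functional b T W (fun i => (xy i).2)).
split; [exact: max_functional_supporting|exact: max_functional_supporting|].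
move=> gE; have DTS := bounded_ops_comp DT DS.
have e4 : 0 < M ^+ 2 * e / 4 by rewrite divr_gt0 ?mulr_gt0 ?exprn_gt0.
have [d d0 dP] := form_at_max hb DT NT0 DS e4.
have cx := max_functional_cvg hb DT NT0 UW xT DTS.
have cy := max_functional_cvg hb DT NT0 UW yT DTS.
have /(ultra_ex UW)[i [[/= xd yd] [hx hy]]] := ultraI UW
  (ultraI UW (near_max_eventually UW fW xT d0) (near_max_eventually UW fW yT d0))
  (ultraI UW (cx _ e4) (cy _ e4)).
have [_ _] := xyP i; rewrite gE in hx.
have := dP _ xd; have := dP _ yd; move: hx hy.
move: (oR M * _) => l; rewrite /=.
set u := b (T (S (xy i).1)) _; set v := b (T (S (xy i).2)) _.
set p := b (S (xy i).1) _; set q := b (S (xy i).2) _.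
move=> h1 h2 h3 h4 h5.
have h6 : M ^+ 2 * e < M ^+ 2 * (re p - re q) by rewrite ltr_pM2l ?exprn_gt0.
have : `|re (oR (M ^+ 2) * p - oR (M ^+ 2) * q)| <= M ^+ 2 * e.
  apply: le_trans (scalar_re_norm_sabs _) _.
  have -> : oR (M ^+ 2) * p - oR (M ^+ 2) * q = - (u - oR (M ^+ 2) * p)
      + ((u - l) + (- (v - l) + (v - oR (M ^+ 2) * q))) by ring.
  apply: le_trans (sabsD _ _) _; rewrite sabsN.
  have := sabsD (u - l) (- (v - l) + (v - oR (M ^+ 2) * q)).
  by have := sabsD (- (v - l)) (v - oR (M ^+ 2) * q); rewrite sabsN; lra.
rewrite scalar_reD scalar_reN !scalar_re_realM ler_norml => /andP[_].
by move: h6; lra.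
Qed.

Lemma smooth_cauchy_at_max S : smooth_point D N T -> D S -> cauchy_at_max b T S.
Proof.
move=> [_ _ [f _ fu]] DS; apply: contrapT => /(not_cauchy_at_max DS).
move=> [g1 [g2 [s1 s2]]]; apply; have DTS := bounded_ops_comp DT DS.
by rewrite (fu _ s1) // (fu _ s2).
Qed.

(** Two values [c1] and [c2] of supporting functionals at [T \o S] make [T]
    orthogonal to [T \o S - c1 T] and to [c2 T - T \o S], hence, by additivity,
    to a nonzero multiple of itself. *)
Lemma additive_cauchy_at_max S : D S ->
  (forall c1 c2 : K, bj_orthogonal N T ((T \o S) - c1 *: T) ->
     bj_orthogonal N T (c2 *: T - (T \o S)) ->
     bj_orthogonal N T (((T \o S) - c1 *: T) + (c2 *: T - (T \o S)))) ->
  cauchy_at_max b T S.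
Proof.
move=> DS add; apply: contrapT => /(not_cauchy_at_max DS) [g1 [g2 [s1 s2]]].
apply; have DTS := bounded_ops_comp DT DS.
have orth g (sg : supporting D N T g) :
    bj_orthogonal N T ((T \o S) - oR M^-1 * g (T \o S) *: T) /\
    bj_orthogonal N T (oR M^-1 * g (T \o S) *: T - (T \o S)).
  have h a : g (a *: (- (oR M^-1 * g (T \o S)) *: T + (T \o S))) = 0.
    rewrite (supporting_linearZ _ sg); last exact: bounded_opsP.
    have [lg _ _ gT] := sg; rewrite lg // gT mulNr mulrAC -scalar_realM mulVf //.
    by rewrite scalar_real1 mul1r addNr mulr0.
  split; apply: (supporting_bj sg).
  - by rewrite addrC -scaleNr; exact: bounded_opsP.
  - by have := h 1; rewrite scale1r scaleNr addrC.
  - by rewrite -scaleN1r addrC; apply: bounded_opsP => //; exact: bounded_opsZ.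
  - by have := h (-1); rewrite scaleN1r scaleNr opprD opprK.
have := add _ _ (orth _ s1).1 (orth _ s2).2.
rewrite addrC addrA subrK -scalerBl -mulrBr; set c := _ * _ => Tc.
apply/eqP; rewrite -subr_eq0; apply/negP => c0'.
have c0 : c != 0.
  rewrite /c mulf_neq0 ?scalar_real_eq0 ?invr_eq0 //.
  by apply/negP; rewrite subr_eq0 eq_sym -subr_eq0.
have := Tc (- c^-1); rewrite scalerA mulNr mulVf // scaleN1r subrr.
apply/negP; rewrite -ltNge; apply: le_lt_trans M0.
by apply: op_norm_lub => // x _; rewrite -[X in n X]/(0 : E) (form_norm0 hb).
Qed.

Section Aligned.
Hypothesis alT : aligned_maximizers b T.
Variables (W : set_system nat) (UW : UltraFilter W).
Hypothesis freeW : forall m : nat, W [set i | (m <= i)%N].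
Variables (x : nat -> E) (xT : maximizing_seq b T x).
Local Notation f := (max_functional b T W x).

Lemma aligned_max_functional S e : D S -> 0 < e -> exists2 d : R, 0 < d &
  forall y, near_max b T d y -> sabs (b (S y) (T y) - oR M * f S) <= e.
Proof.
move=> DS e0; have e2 : 0 < e / 2 by rewrite divr_gt0.
have [d d0 dP] := aligned_form_cauchy hb DT NT0 alT DS e2.
exists d => // y yd.
have cx := max_functional_cvg hb DT NT0 UW xT DS.
have /(ultra_ex UW)[i [/= xd hx]] :=
  ultraI UW (near_max_eventually UW freeW xT d0) (cx _ e2).
have := sabsD (b (S y) (T y) - b (S (x i)) (T (x i)))
  (b (S (x i)) (T (x i)) - oR M * f S); rewrite addrA subrK.
by have := dP _ _ yd xd; lra.
Qed.

(** The operator norm is differentiable at [T] with derivative [f], so moving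
    against a nonzero value of [f] lowers the norm. *)
Lemma aligned_bj_functional V : D V -> bj_orthogonal N T V -> f V = 0.
Proof.
move=> DV TV; apply: sabs_eq0; apply/eqP; rewrite eq_le sabs_ge0 andbT leNgt.
apply/negP => l0; set l := sabs (f V) in l0.
have [c c1 cE] := scalar_phase (f V).
have e0 : 0 < M * l / 4 by rewrite divr_gt0 ?mulr_gt0.
have [d d0 dP] := aligned_max_functional DV e0.
have DU : D (- c *: V) by exact: bounded_opsZ.
have [y yd|r r0 rP] := @op_norm_perturb _ _ _ _ hb _ DT NT0 _
  (- (M * l) + M * l / 4) _ _ DU d0 e0.
  rewrite -[X in b X _]/(- c *: V y) (formZl hb) mulNr scalar_reN.
  have := scalar_re_norm_sabs (c * (b (V y) (T y) - oR M * f V)).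
  rewrite sabsM c1 mul1r mulrBr (mulrCA c) cE scalar_reD scalar_reN.
  rewrite scalar_re_realM scalar_re_real ler_norml => /andP[h _].
  by have := dP y yd; rewrite -/l in h *; lra.
have := TV (oR r * - c); apply/negP; rewrite -ltNge.
have lt_sq : M ^+ 2 - M * l * r < M ^+ 2 by rewrite ltrBlDr ltrDl !mulr_gt0.
have le_max : N (T + (oR r * - c) *: V) ^+ 2 <= Num.max 0 (M ^+ 2 - M * l * r).
  apply: le_trans (_ : Num.sqrt (Num.max 0 (M ^+ 2 - M * l * r)) ^+ 2 <= _); last first.
    by rewrite sqr_sqrtr // le_max lexx.
  rewrite ler_pXn2r ?nnegrE ?op_norm_ge0 ?sqrtr_ge0 //.
  apply: op_norm_lub; first exact: sqrtr_ge0.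
  move=> y y1; rewrite -(ger0_norm (form_norm_ge0 b _)) -sqrtr_sqr.
  rewrite ler_sqrt ?le_max ?lexx //; apply/orP; right.
  have := rP y y1; rewrite -[X in n X]/(T y + oR r *: (- c *: V y)) scalerA => h.
  rewrite -[X in n X]/(T y + (oR r * - c) *: V y).
  by apply: le_trans h _; lra.
rewrite -(@ltr_pXn2r _ 2) ?nnegrE ?op_norm_ge0 //.
by apply: le_lt_trans le_max _; rewrite gt_max exprn_gt0.
Qed.

End Aligned.

Lemma aligned_bj_additive S1 S2 : aligned_maximizers b T -> D S1 -> D S2 ->
  bj_orthogonal N T S1 -> bj_orthogonal N T S2 -> bj_orthogonal N T (S1 + S2).
Proof.
move=> alT D1 D2 T1 T2.
have [W [UW fW]] := free_ultrafilter.
have [x xT] := maximizing_seq_ex NT0.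
have sf := max_functional_supporting hb DT NT0 UW fW xT.
have D12 : D (S1 + S2) by rewrite -[S1]scale1r; exact: bounded_opsP.
apply: (supporting_bj sf) => //.
have [lf _ _ _] := sf; rewrite -[S1]scale1r lf // mul1r.
rewrite (aligned_bj_functional alT UW fW xT D1 T1).
by rewrite (aligned_bj_functional alT UW fW xT D2 T2) addr0.
Qed.

(** Any supporting functional is bounded by the norm, hence tangent to
    it, and so equal to the derivative [f]. *)
Lemma aligned_smooth : aligned_maximizers b T -> smooth_point D N T.
Proof.
move=> alT; have [W [UW fW]] := free_ultrafilter.
have [x xT] := maximizing_seq_ex NT0.
have sf := max_functional_supporting hb DT NT0 UW fW xT.
split=> //.
  move=> T0; have /negP := NT0; apply; rewrite T0 eq_le op_norm_ge0 andbT.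
  by apply: op_norm_lub => // y _; rewrite -[X in n X]/(0 : E) (form_norm0 hb).
exists (max_functional b T W x) => // g sg V DV; set f := max_functional b T W x.
have [lg _ _ gT] := sg; have [lf _ _ fT] := sf; rewrite -/f in lf fT.
pose V' := - (oR M^-1 * f V) *: T + V.
have DV' : D V' by exact: bounded_opsP.
have fV' : f V' = 0.
  rewrite lf // fT mulNr mulrAC -scalar_realM mulVf // scalar_real1 mul1r.
  by rewrite addNr.
suff gV' : g V' = 0.
  have := gV'; rewrite lg // gT mulNr mulrAC -scalar_realM mulVf // scalar_real1.
  by rewrite mul1r => /eqP; rewrite addrC subr_eq0 => /eqP.
apply: sabs_eq0; apply/eqP; rewrite eq_le sabs_ge0 andbT.
rewrite -(ler_pM2l M0) mulr0; apply/ler_addgt0Pr => e e0; rewrite add0r.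
have [c c1 cE] := scalar_phase (g V').
have e2 : 0 < e / 2 by rewrite divr_gt0.
have [d d0 dP] := aligned_max_functional alT UW fW xT DV' e2.
have DU : D (c *: V') by exact: bounded_opsZ.
have [y yd|r r0 rP] := @op_norm_perturb _ _ _ _ hb _ DT NT0 _ (e / 2) _ _ DU d0 e2.
  rewrite -[X in b X _]/(c *: V' y) (formZl hb).
  apply: le_trans (scalar_re_le_sabs _) _; rewrite sabsM c1 mul1r.
  by have := dP y yd; rewrite -/f fV' mulr0 subr0.
have DTV : D (oR r * c *: V' + T) by exact: bounded_opsP.
have := sabs_supporting_le sg DTV.
rewrite lg // gT -mulrA cE -scalar_realM -scalar_realD sabs_real.
set l := sabs (g V'); have l0 : 0 <= l by exact: sabs_ge0.
rewrite ger0_norm ?addr_ge0 ?mulr_ge0 ?(ltW r0) ?(ltW M0) // => h.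
have c0 : 0 <= M ^+ 2 + 2 * r * (e / 2 + e / 2).
  by rewrite addr_ge0 ?sqr_ge0 // mulr_ge0 ?mulr_ge0 ?(ltW r0) ?addr_ge0 ?ltW.
have Nle : N (oR r * c *: V' + T) ^+ 2 <= M ^+ 2 + 2 * r * (e / 2 + e / 2).
  rewrite -[leRHS]sqr_sqrtr // ler_pXn2r ?nnegrE ?op_norm_ge0 ?sqrtr_ge0 //.
  apply: op_norm_lub; first exact: sqrtr_ge0.
  move=> y y1; rewrite -(ger0_norm (form_norm_ge0 b _)) -sqrtr_sqr.
  rewrite ler_sqrt //.
  have := rP y y1; rewrite -[X in n X]/(T y + oR r *: (c *: V' y)) scalerA.
  by rewrite addrC.
have h2 : (r * l + M) ^+ 2 <= N (oR r * c *: V' + T) ^+ 2.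
  by rewrite ler_pXn2r ?nnegrE ?op_norm_ge0 ?addr_ge0 ?mulr_ge0 ?(ltW r0) ?(ltW M0).
have h3 : r * (M * l) <= r * e.
  by have := sqr_ge0 (r * l); move: h2 Nle; rewrite sqrrD; lra.
by rewrite -(ler_pM2l r0).
Qed.

End Smoothness.

(** * Alignment from a single nonvanishing overlap *)

Section Overlap.
Variables (R : realType) (k : scalar_kind).
Local Notation K := (scalar_field R k).
Local Notation oR := (@scalar_of_real R k).
Variables (E : lmodType K) (b : E -> E -> K) (hb : semi_inner b).
Local Notation n := (form_norm b).
Local Notation N := (op_norm n).
Local Notation D := (bounded_ops n).
Variables (T : E -> E) (DT : D T) (NT0 : N T != 0).
Local Notation M := (N T).
Let M0 : 0 < M := op_norm_gt0 NT0.

(** A small defect relative to the norm is what near-maximality means. *)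
Lemma near_max_normalize d u : 0 < d -> d <= M -> n u != 0 ->
  form_norm (defect_form b T) u ^+ 2 < M * d * n u ^+ 2 ->
  near_max b T d (oR (n u)^-1 *: u).
Proof.
move=> d0 dM u0 qu; have u1 : 0 < n u by rewrite lt0r u0 form_norm_ge0.
split; first exact: form_norm_normalize.
rewrite (linear_applyZ DT.1) (form_normZr hb) ?invr_ge0 ?(ltW u1) //.
rewrite mulrC ltr_pdivlMr // -(@ltr_pXn2r _ 2) ?nnegrE ?form_norm_ge0 //; last first.
  by rewrite mulr_ge0 ?form_norm_ge0 ?subr_ge0.
move: qu; rewrite (sqr_defect_norm hb DT NT0) exprMn sqrrB.
have : d ^+ 2 * n u ^+ 2 <= M * d * n u ^+ 2.
  by rewrite ler_wpM2r ?sqr_ge0 // expr2 ler_pM2r.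
by lra.
Qed.

(** If the overlap with a fixed vector [v] tends to a positive limit along the
    near-maximizing vectors [x], then the vectors [b v x *: x], which do not
    depend on the phase of [x], form a Cauchy family: the sum of two of them is
    again nearly maximizing, so that its own overlap with [v] gives its norm,
    and the parallelogram law bounds the difference. *)
Lemma aligned_of_overlap v beta d0 : 0 < beta -> 0 < d0 ->
  (forall x, near_max b T d0 x -> beta <= sabs (b x v) ^+ 2) ->
  (forall e, 0 < e -> exists2 d, 0 < d & forall x y,
     near_max b T d x -> near_max b T d y ->
     sabs (b x v) ^+ 2 - sabs (b y v) ^+ 2 <= e) ->
  aligned_maximizers b T.
Proof.
move=> beta0 d00 gbeta gC e e0.
(* The estimates below give [1 - sabs (b x y) <= 3 * eps / beta]. *)
pose eps := beta * e / 3; have eps0 : 0 < eps by rewrite divr_gt0 ?mulr_gt0.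
have [d1 d10 gd1] := gC _ eps0.
pose d2 := Num.min M (Num.min d0 d1).
have d20 : 0 < d2 by rewrite !lt_min M0 d00.
have d2M : d2 <= M by rewrite ge_min lexx.
have d2d0 : d2 <= d0 by rewrite !ge_min lexx !orbT.
have d2d1 : d2 <= d1 by rewrite !ge_min lexx !orbT.
have [G GE] : exists G, G = n v ^+ 2 by exists (n v ^+ 2).
have g_le x : n x = 1 -> sabs (b x v) ^+ 2 <= G.
  move=> x1; rewrite GE ler_pXn2r ?nnegrE ?sabs_ge0 ?form_norm_ge0 //.
  by have := form_cauchy_schwarz hb x v; rewrite x1 mul1r.
have G0 : 0 < G.
  have [x xd] := near_max_ex NT0 d00.
  by apply: lt_le_trans beta0 (le_trans (gbeta _ xd) (g_le x xd.1)).
(* Small enough for the defect of the sum [u] to stay below [M * d2 * n u ^+ 2]. *)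
pose d := Num.min d2 (d2 * beta ^+ 2 / (4 * G ^+ 2)).
have dq : 0 < d2 * beta ^+ 2 / (4 * G ^+ 2).
  by rewrite divr_gt0 ?mulr_gt0 ?exprn_gt0.
have dd2 : d <= d2 by rewrite ge_min lexx.
have dM : d <= M by exact: le_trans dd2 d2M.
have dG : d * (4 * G ^+ 2) <= d2 * beta ^+ 2.
  by rewrite -ler_pdivlMr ?mulr_gt0 ?exprn_gt0 // ge_min lexx orbT.
exists d; first by rewrite lt_min d20.
move=> x y xd yd.
have x2 := near_max_sub dd2 xd; have y2 := near_max_sub dd2 yd.
have gx := gbeta _ (near_max_sub d2d0 x2); have gy := gbeta _ (near_max_sub d2d0 y2).
have gxy := gd1 _ _ (near_max_sub d2d1 x2) (near_max_sub d2d1 y2).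
have gyx := gd1 _ _ (near_max_sub d2d1 y2) (near_max_sub d2d1 x2).
have gxG := g_le _ xd.1; have gyG := g_le _ yd.1.
pose xi z := b v z *: z.
have xi_v z : b (xi z) v = oR (sabs (b z v) ^+ 2).
  by rewrite /xi (formZl hb) (formC hb) mulrC scalar_mul_conj.
have n_xi z : n z = 1 -> n (xi z) ^+ 2 = sabs (b z v) ^+ 2.
  by move=> z1; rewrite /xi (form_normZ hb) z1 mulr1 (formC hb) sabs_conj.
have hq := defect_form_semi_inner hb DT NT0.
have q_xi z : near_max b T d z ->
    form_norm (defect_form b T) (xi z) ^+ 2 <= G * (2 * M * d).
  move=> zd; rewrite /xi (form_normZ hq) exprMn (formC hb) sabs_conj.
  by rewrite ler_pM ?sqr_ge0 ?g_le ?zd.1 // (sqr_defect_near_max hb DT NT0).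
set s := sabs (b x v) in gx gxy gyx gxG; set t := sabs (b y v) in gy gxy gyx gyG.
have s0 : 0 <= s := sabs_ge0 _; have t0 : 0 <= t := sabs_ge0 _.
pose u := xi x + xi y.
have u_v : b u v = oR (s ^+ 2 + t ^+ 2) by rewrite (formDl hb) !xi_v scalar_realD.
have st0 : 0 < s ^+ 2 + t ^+ 2 by lra.
have uG : (s ^+ 2 + t ^+ 2) ^+ 2 <= n u ^+ 2 * G.
  rewrite GE -exprMn ler_pXn2r ?nnegrE ?mulr_ge0 ?form_norm_ge0 ?(ltW st0) //.
  by have := form_cauchy_schwarz hb u v; rewrite u_v sabs_real (gtr0_norm st0).
have u0 : n u != 0.
  apply/negP => /eqP u0; move: uG; rewrite u0 expr0n mul0r leNgt /=.
  by rewrite exprn_gt0.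
have u20 : 0 < n u ^+ 2 by rewrite lt0r sqrf_eq0 u0 sqr_ge0.
have qu : form_norm (defect_form b T) u ^+ 2 < M * d2 * n u ^+ 2.
  have := form_parallelogram hq (xi x) (xi y); rewrite -/u.
  have := sqr_ge0 (form_norm (defect_form b T) (xi x - xi y)).
  have := q_xi _ xd; have := q_xi _ yd => h1 h2 h3 h4.
  have h5 : form_norm (defect_form b T) u ^+ 2 <= 8 * G * M * d by lra.
  apply: le_lt_trans h5 _; rewrite -(ltr_pM2r G0).
  have h6 : M * d2 * (s ^+ 2 + t ^+ 2) ^+ 2 <= M * d2 * (n u ^+ 2 * G).
    by rewrite ler_pM2l ?mulr_gt0.
  have h7 : M * (d * (4 * G ^+ 2)) <= M * (d2 * beta ^+ 2) by rewrite ler_pM2l.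
  have h8 : M * d2 * (2 * beta) ^+ 2 <= M * d2 * (s ^+ 2 + t ^+ 2) ^+ 2.
    rewrite ler_pM2l ?mulr_gt0 // ler_pXn2r ?nnegrE ?mulr_ge0 ?(ltW beta0) //.
      by lra.
    exact: ltW.
  have h9 : 0 < M * d2 * beta ^+ 2 by rewrite !mulr_gt0 ?exprn_gt0.
  by lra.
have ud := near_max_sub d2d1 (near_max_normalize d20 d2M u0 qu).
have := gd1 _ _ ud (near_max_sub d2d1 x2).
rewrite (formZl hb) sabsM u_v !sabs_real ger0_norm ?invr_ge0 ?form_norm_ge0 //.
rewrite (gtr0_norm st0) -/s exprMn exprVn mulrC => gu.
have {}gu : (s ^+ 2 + t ^+ 2) ^+ 2 <= (s ^+ 2 + eps) * n u ^+ 2.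
  by rewrite -ler_pdivrMr // ; lra.
have par := form_parallelogram hb (xi x) (xi y).
rewrite -/u !n_xi ?xd.1 ?yd.1 // -/s -/t in par.
set w := n (xi x - xi y) ^+ 2 in par.
have w6 : w <= 6 * eps.
  have c0 : 0 < s ^+ 2 + eps by rewrite addr_gt0 //; lra.
  rewrite -(ler_pM2l c0).
  have -> : w = 2 * s ^+ 2 + 2 * t ^+ 2 - n u ^+ 2 by lra.
  have h1 : (s ^+ 2 + eps) * (2 * s ^+ 2 + 2 * t ^+ 2) -
      (s ^+ 2 + t ^+ 2) ^+ 2 <= (s ^+ 2 + eps) * (6 * eps).
    move: gxy gyx gx beta0 eps0; move: (s ^+ 2) (t ^+ 2) => p q h1 h2 h3 h4 h5.
    have h6 : 0 <= p * (eps + (q - p)) by rewrite mulr_ge0; lra.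
    have h7 : 0 <= eps * (eps - (q - p)) by rewrite mulr_ge0; lra.
    have h8 : 0 <= (q - p) ^+ 2 by rewrite sqr_ge0.
    have h9 : 0 <= eps ^+ 2 by rewrite sqr_ge0.
    by lra.
  by move: gu h1; lra.
have := sqr_form_normB hb (xi x) (xi y).
rewrite -/w !n_xi ?xd.1 ?yd.1 // -/s -/t => wE.
have xi_xi : sabs (b (xi x) (xi y)) = s * (t * sabs (b x y)).
  rewrite /xi (formZl hb) (formZr hb) !sabsM sabs_conj.
  by rewrite (formC hb x v) (formC hb y v) !sabs_conj.
have := scalar_re_le_sabs (b (xi x) (xi y)); rewrite xi_xi => h.
have st : beta <= s * t.
  rewrite -(@ler_pXn2r _ 2) ?nnegrE ?mulr_ge0 ?(ltW beta0) // exprMn expr2.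
  by rewrite ler_pM ?(ltW beta0).
have h1 : 0 <= (s - t) ^+ 2 by exact: sqr_ge0.
have h2 : s * t * (1 - sabs (b x y)) <= 3 * eps.
  by move: h h1; rewrite sqrrB; lra.
have h3 : s * t * (1 - sabs (b x y)) <= s * t * e.
  apply: le_trans h2 _; rewrite /eps mulrC divfK ?pnatr_eq0 //.
  by rewrite ler_pM2r.
by move: h3; rewrite ler_pM2l ?(lt_le_trans beta0) //; lra.
Qed.

End Overlap.

(** * Strong limits and the gliding hump *)

Section Hilbert.
Variables (R : realType) (k : scalar_kind).
Local Notation K := (scalar_field R k).
Local Notation re := (@scalar_re R k).
Local Notation cj := (@scalar_conj R k).
Local Notation oR := (@scalar_of_real R k).
Variables (H : completeNormedModType K) (ip : {dot H for @scalar_conj R k}).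
Hypothesis ip_norm : forall x : H, ip x x = `|x| ^+ 2.
Local Notation n := (form_norm ip).
Implicit Types (x y z : H) (B C D L : H -> H).

Lemma dot_semi_inner : semi_inner ip.
Proof.
split=> [a x y z|x y|x].
- by rewrite linearDl linearZl_LR.
- by have := @hermitian_subproof _ _ _ _ ip y x; rewrite expr0 mul1r.
- by rewrite ip_norm scalar_ge0_re // exprn_ge0.
Qed.
Let hip := dot_semi_inner.

Lemma dot_normE x : `|x| = oR (n x).
Proof.
apply/eqP; rewrite -(eqrXn2 (n := 2)) ?scalar_real_ge0 ?form_norm_ge0 //.
by rewrite -ip_norm (form_self hip) expr2 scalar_realM -expr2.
Qed.

Lemma norm_lt_re x (e : K) : 0 < e -> n x < re e -> `|x| < e.
Proof.
move=> e0 xe; rewrite dot_normE (scalar_ge0_real (ltW e0)) -subr_gt0.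
by rewrite -scalar_realN -scalar_realD scalar_real_gt0 subr_gt0.
Qed.

Lemma form_norm_eq0 x : n x = 0 -> x = 0.
Proof. by move=> x0; apply/eqP; rewrite -normr_eq0 dot_normE x0 scalar_real0. Qed.

Lemma gt0_re (e : K) : 0 < e -> 0 < re e.
Proof. by move=> e0; rewrite -(@scalar_real_gt0 R k) -scalar_ge0_real // ltW. Qed.

Definition seq_cvg (u : nat -> H) l := forall e : R, 0 < e ->
  exists m : nat, forall i, (m <= i)%N -> n (u i - l) <= e.

Lemma seq_cauchy_cvg (u : nat -> H) :
  (forall e : R, 0 < e -> exists m : nat, forall i,
     (m <= i)%N -> n (u i - u m) <= e) ->
  exists l, seq_cvg u l.
Proof.
move=> uC.
have : cvg (u @ \oo).
  apply: cauchy_cvg; apply: cauchy_exP => e e0.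
  have e2 : 0 < re e / 2 by rewrite divr_gt0 ?gt0_re.
  have [m mP] := uC _ e2; exists (u m); exists m => // i /= mi.
  rewrite -ball_normE /=; apply: norm_lt_re => //.
  rewrite (form_normBC hip); apply: le_lt_trans (mP i mi) _.
  by rewrite ltr_pdivrMr // ltr_pMr ?gt0_re // ltr1n.
move=> /cvg_ex [l ul]; exists l => e e0.
have /cvgrPdist_lt ul' := ul.
have e0' : 0 < oR e by rewrite scalar_real_gt0.
have [m _ mP] := ul' _ e0'; exists m => i mi.
have := mP i mi; rewrite /= distrC dot_normE -subr_gt0 -scalar_realN -scalar_realD.
by rewrite scalar_real_gt0 subr_gt0 => /ltW.
Qed.

Lemma seq_cvg_unique u l l' : seq_cvg u l -> seq_cvg u l' -> l = l'.
Proof.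
move=> ul ul'; apply/eqP; rewrite -subr_eq0; apply/eqP/form_norm_eq0/eqP.
rewrite eq_le form_norm_ge0 andbT; apply/ler_addgt0Pr => e e0; rewrite add0r.
have e2 : 0 < e / 2 by rewrite divr_gt0.
have [m mP] := ul _ e2; have [m' mP'] := ul' _ e2.
have h := mP _ (leq_maxl m m'); have h' := mP' _ (leq_maxr m m').
have := form_normD hip (l - u (maxn m m')) (u (maxn m m') - l').
by rewrite addrA subrK (form_normBC hip l (u _)); lra.
Qed.

Lemma seq_cvgD a u v l l' : seq_cvg u l -> seq_cvg v l' ->
  seq_cvg (fun i => a *: u i + v i) (a *: l + l').
Proof.
move=> ul ul' e e0.
have c0 : 0 < sabs a + 1 by rewrite ltr_wpDl ?sabs_ge0.
have ec : 0 < e / 2 / (sabs a + 1) by rewrite !divr_gt0.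
have e2 : 0 < e / 2 by rewrite divr_gt0.
have [m mP] := ul _ ec; have [m' mP'] := ul' _ e2.
exists (maxn m m') => i; rewrite geq_max => /andP[/mP h /mP' h'].
have -> : a *: u i + v i - (a *: l + l') = a *: (u i - l) + (v i - l').
  by rewrite scalerBr opprD addrACA.
apply: le_trans (form_normD hip _ _) _; rewrite (form_normZ hip).
have h2 : sabs a * n (u i - l) <= e / 2.
  apply: le_trans (_ : _ <= (sabs a + 1) * n (u i - l)) _.
    by rewrite ler_wpM2r ?form_norm_ge0 // lerDl.
  by rewrite mulrC -ler_pdivlMr.
by lra.
Qed.

Lemma seq_cvg_map L u l (c : R) : linear L -> (forall x, n (L x) <= c * n x) ->
  seq_cvg u l -> seq_cvg (fun i => L (u i)) (L l).
Proof.
move=> lL Lc ul e e0.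
have c0 : 0 < `|c| + 1 by rewrite ltr_wpDl.
have [m mP] := ul _ (divr_gt0 e0 c0); exists m => i /mP h.
rewrite -(linear_applyB lL); apply: le_trans (Lc _) _.
apply: le_trans (_ : (`|c| + 1) * n (u i - l) <= _); last first.
  by rewrite mulrC -ler_pdivlMr.
by rewrite ler_wpM2r ?form_norm_ge0 // (le_trans (ler_norm c)) // lerDl.
Qed.

Lemma seq_cvg_form u l y e : seq_cvg u l -> 0 < e ->
  exists m : nat, forall i, (m <= i)%N -> sabs (ip (u i) y - ip l y) <= e.
Proof.
move=> ul e0; have c0 : 0 < n y + 1 by rewrite ltr_wpDl ?form_norm_ge0.
have [m mP] := ul _ (divr_gt0 e0 c0); exists m => i /mP h.
rewrite -(formBl hip); apply: le_trans (form_cauchy_schwarz hip _ _) _.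
apply: le_trans (_ : n (u i - l) * (n y + 1) <= _).
  by rewrite ler_wpM2l ?form_norm_ge0 // lerDl.
by rewrite -ler_pdivlMr.
Qed.

Definition symmetric_op B := forall x y, ip (B x) y = ip x (B y).

Definition positive_contraction B := [/\ linear B, symmetric_op B
  & forall x, 0 <= re (ip (B x) x) <= n x ^+ 2].

(** Cauchy-Schwarz for the form of [B], applied to [x] and [B x]. *)
Lemma sqr_positive_contraction B x : positive_contraction B ->
  n (B x) ^+ 2 <= re (ip (B x) x).
Proof.
move=> [lB sB pB].
have hB : semi_inner (fun x y => ip (B x) y).
  split=> [a u v w|u v|u]; first by rewrite lB (formDl hip) (formZl hip).
    by rewrite sB (formC hip).
  by case/andP: (pB u).
have [h0 h1] := andP (pB (B x)).
have := form_cauchy_schwarz hB x (B x); rewrite (form_self hip) sabs_real.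
rewrite ger0_norm ?sqr_ge0 // => h.
have [->|Bx0] := eqVneq (n (B x)) 0.
  by rewrite expr0n; case/andP: (pB x).
have B0 : 0 < n (B x) ^+ 2 by rewrite exprn_gt0 // lt0r Bx0 form_norm_ge0.
rewrite -(ler_pM2r B0).
have h2 : (n (B x) ^+ 2) ^+ 2 <= re (ip (B x) x) * re (ip (B (B x)) (B x)).
  rewrite -!(sqr_form_norm hB) -exprMn.
  by rewrite ler_pXn2r ?nnegrE ?mulr_ge0 ?form_norm_ge0 ?sqr_ge0.
rewrite -expr2; apply: le_trans h2 _.
by rewrite ler_wpM2l //; case/andP: (pB x).
Qed.

Lemma positive_contraction_le B x : positive_contraction B -> n (B x) <= n x.
Proof.
move=> pB; rewrite -(@ler_pXn2r _ 2) ?nnegrE ?form_norm_ge0 //.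
apply: le_trans (sqr_positive_contraction x pB) _.
by case: pB => _ _ /(_ x) /andP[].
Qed.

Lemma monotone_bounded_cauchy (a : nat -> R) (c e : R) :
  (forall i j, (i <= j)%N -> a i <= a j) -> (forall i, a i <= c) -> 0 < e ->
  exists m : nat, forall i, (m <= i)%N -> a i - a m <= e.
Proof.
move=> amono ac e0.
have hs : has_sup (range a).
  by split; [exists (a 0%N), 0%N|exists c => _ [i _ <-]].
have [_ [m _ <-] am] := sup_adherent e0 hs; exists m => i mi.
have := sup_upper_bound hs (imageT a i).
by move: am; lra.
Qed.

(** The quadratic forms [ip (B i x) x] are bounded and increasing, hence Cauchy,
    and for a positive contraction they control the norm. *)
Lemma strong_limit (B : nat -> H -> H) :
  (forall i j, (i <= j)%N -> positive_contraction (fun x => B j x - B i x)) ->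
  (forall x, B 0%N x = 0) ->
  exists D, positive_contraction D /\ forall x, seq_cvg (B^~ x) (D x).
Proof.
move=> Bmono B00.
have pB j : positive_contraction (B j).
  have := Bmono 0%N j (leq0n j); congr positive_contraction.
  by apply/funext => x; rewrite B00 subr0.
have /choice[D Dlim] x : exists l, seq_cvg (B^~ x) l.
  apply: seq_cauchy_cvg => e e0.
  have [|||m mP] := @monotone_bounded_cauchy (fun i => re (ip (B i x) x))
    (n x ^+ 2) (e ^+ 2).
  - move=> i j ij; case: (Bmono i j ij) => _ _ /(_ x) /andP[h _].
    by move: h; rewrite (formBl hip) scalar_reD scalar_reN subr_ge0.
  - by move=> i; case: (pB i) => _ _ /(_ x) /andP[].
  - by rewrite exprn_gt0.
  exists m => i mi; rewrite -(@ler_pXn2r _ 2) ?nnegrE ?form_norm_ge0 ?(ltW e0) //.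
  apply: le_trans (sqr_positive_contraction x (Bmono m i mi)) _.
  by rewrite (formBl hip) scalar_reD scalar_reN mP.
exists D; split=> //.
have reD x e : 0 < e -> exists i, `|re (ip (B i x) x) - re (ip (D x) x)| <= e.
  move=> e0; have [m mP] := seq_cvg_form x (Dlim x) e0; exists m.
  rewrite -scalar_reN -scalar_reD.
  by apply: le_trans (scalar_re_norm_sabs _) (mP m (leqnn m)).
split=> [a x y|x y|x].
- apply: (seq_cvg_unique (Dlim _)).
  have := seq_cvgD a (Dlim x) (Dlim y); congr seq_cvg.
  by apply/funext => i; case: (pB i) => ->.
- apply/eqP; rewrite -subr_eq0; apply/eqP/sabs_eq0/eqP.
  rewrite eq_le sabs_ge0 andbT; apply/ler_addgt0Pr => e e0; rewrite add0r.
  have e2 : 0 < e / 2 by rewrite divr_gt0.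
  have [m mP] := seq_cvg_form y (Dlim x) e2.
  have [m' mP'] := seq_cvg_form x (Dlim y) e2.
  have h := mP _ (leq_maxl m m'); have h' := mP' _ (leq_maxr m m').
  move: h h'; set i := maxn m m' => h h'.
  have -> : ip (D x) y - ip x (D y) =
      - (ip (B i x) y - ip (D x) y) + cj (ip (B i y) x - ip (D y) x).
    rewrite scalar_conjD scalar_conjN -!(formC hip).
    by case: (pB i) => _ -> _; rewrite opprB addrA subrK.
  apply: le_trans (sabsD _ _) _; rewrite sabsN sabs_conj.
  by lra.
- apply/andP; split; apply/ler_addgt0Pr => e e0.
    have [i hi] := reD x e e0; move: hi; rewrite ler_norml => /andP[_ h].
    by case: (pB i) => _ _ /(_ x) /andP[h1 h2]; lra.
  have [i hi] := reD x e e0; move: hi; rewrite ler_norml => /andP[h _].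
  by case: (pB i) => _ _ /(_ x) /andP[h1 h2]; lra.
Qed.

Lemma strong_limit_re_le (B : nat -> H -> H) D x (c : R) : seq_cvg (B^~ x) (D x) ->
  (exists m : nat, forall i, (m <= i)%N -> re (ip (B i x) x) <= c) ->
  re (ip (D x) x) <= c.
Proof.
move=> BD [m mc]; apply/ler_addgt0Pr => e e0.
have [m' mP'] := seq_cvg_form x BD e0.
have := mP' _ (leq_maxr m m'); have := mc _ (leq_maxl m m').
have := scalar_re_norm_sabs (ip (B (maxn m m') x) x - ip (D x) x).
by rewrite scalar_reD scalar_reN ler_norml => /andP[h _]; lra.
Qed.

Lemma strong_limit_re_ge (B : nat -> H -> H) D x (c : R) : seq_cvg (B^~ x) (D x) ->
  (exists m : nat, forall i, (m <= i)%N -> c <= re (ip (B i x) x)) ->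
  c <= re (ip (D x) x).
Proof.
move=> BD [m mc]; apply/ler_addgt0Pr => e e0.
have [m' mP'] := seq_cvg_form x BD e0.
have := mP' _ (leq_maxr m m'); have := mc _ (leq_maxl m m').
have := scalar_re_le_sabs (ip (B (maxn m m') x) x - ip (D x) x).
by rewrite scalar_reD scalar_reN; lra.
Qed.

End Hilbert.

Section GlidingHump.
Variables (R : realType) (k : scalar_kind).
Local Notation K := (scalar_field R k).
Local Notation re := (@scalar_re R k).
Variables (H : completeNormedModType K) (ip : {dot H for @scalar_conj R k}).
Hypothesis ip_norm : forall x : H, ip x x = `|x| ^+ 2.
Local Notation n := (form_norm ip).
Let hip := dot_semi_inner ip_norm.

Definition quad (B : H -> H) (x : H) : R := re (ip (B x) x).

Section Blocks.
Variable E_ : nat -> H -> H.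
Hypothesis E_contr : forall i, positive_contraction ip (E_ i).
Hypothesis E0 : forall x, E_ 0%N x = 0.
Hypothesis E_mono : forall i x, quad (E_ i) x <= quad (E_ i.+1) x.

Definition even_blocks m (x : H) : H :=
  \sum_(j < m) (E_ (j : nat).*2.+1 x - E_ (j : nat).*2 x).

Let d i x := quad (E_ i.+1) x - quad (E_ i) x.

Let d_ge0 i x : 0 <= d i x.
Proof. by rewrite subr_ge0. Qed.

Lemma quad_even_blocks m x : quad (even_blocks m) x = \sum_(j < m) d j.*2 x.
Proof.
elim: m => [|m IH].
  by rewrite big_ord0 /quad /even_blocks big_ord0 (form0l hip) scalar_re0.
rewrite big_ord_recr /= -IH /quad /even_blocks big_ord_recr /= (formDl hip).
by rewrite scalar_reD (formBl hip) scalar_reD scalar_reN.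
Qed.

Lemma even_odd_blocks_le m x :
  \sum_(j < m) d j.*2 x + \sum_(j < m) d j.*2.+1 x <= n x ^+ 2.
Proof.
have -> : \sum_(j < m) d j.*2 x + \sum_(j < m) d j.*2.+1 x = quad (E_ m.*2) x.
  elim: m => [|m IH].
    by rewrite !big_ord0 addr0 /quad E0 (form0l hip) scalar_re0.
  by rewrite !big_ord_recr /= addrACA IH /d doubleS; ring.
by case: (E_contr m.*2) => _ _ /(_ x) /andP[].
Qed.

Lemma even_blocks_contr i j : (i <= j)%N ->
  positive_contraction ip (fun x => even_blocks j x - even_blocks i x).
Proof.
move=> ij; have lin m : linear (even_blocks m).
  move=> a x y; rewrite /even_blocks scaler_sumr -big_split /=.
  apply: eq_bigr => l _.
  case: (E_contr l.*2.+1) => -> _ _; case: (E_contr l.*2) => -> _ _.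
  by rewrite scalerBr opprD addrACA.
have sym m : symmetric_op ip (even_blocks m).
  move=> x y; elim: m => [|m IH].
    by rewrite /even_blocks !big_ord0 (form0l hip) (form0r hip).
  rewrite /even_blocks !big_ord_recr /= (formDl hip) (formDr hip) IH.
  rewrite (formBl hip) (formBr hip).
  by case: (E_contr m.*2.+1) => _ -> _; case: (E_contr m.*2) => _ -> _.
split=> [a x y|x y|x].
- by rewrite !lin scalerBr opprD addrACA.
- by rewrite (formBl hip) (formBr hip) !sym.
have -> : re (ip (even_blocks j x - even_blocks i x) x) =
    quad (even_blocks j) x - quad (even_blocks i) x.
  by rewrite (formBl hip) scalar_reD scalar_reN.
have mono : quad (even_blocks i) x <= quad (even_blocks j) x.
  rewrite !quad_even_blocks -(subnKC ij) big_split_ord /= lerDl.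
  by apply: sumr_ge0.
have ge0 : 0 <= quad (even_blocks i) x.
  by rewrite quad_even_blocks; apply: sumr_ge0.
have le1 : quad (even_blocks j) x <= n x ^+ 2.
  apply: le_trans (even_odd_blocks_le j x).
  by rewrite quad_even_blocks lerDl; apply: sumr_ge0.
by apply/andP; split; lra.
Qed.

Lemma even_blocks_limit : exists D, [/\ positive_contraction ip D,
  forall j x, d j.*2 x <= quad D x,
  forall j x, quad D x <= n x ^+ 2 - d j.*2.+1 x &
  forall (L : H -> H) (c : R), linear L -> (forall x, n (L x) <= c * n x) ->
    (forall i x, E_ i (L x) = L (E_ i x)) -> forall x, D (L x) = L (D x)].
Proof.
have [|D [cD Dlim]] := strong_limit ip_norm even_blocks_contr.
  by move=> x; rewrite /even_blocks big_ord0.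
have sum_ge (f : nat -> R) m j : (forall i, 0 <= f i) -> (j < m)%N ->
    f j <= \sum_(i < m) f i.
  move=> f0 jm; rewrite (bigD1 (Ordinal jm)) //= lerDl.
  by apply: sumr_ge0.
exists D; split=> // [j x|j x|L c lL Lc EL x].
- apply: (strong_limit_re_ge ip_norm (Dlim x)); exists j.+1 => i ji.
  by rewrite -/(quad _ _) quad_even_blocks (sum_ge (fun l => d l.*2 x)).
- apply: (strong_limit_re_le ip_norm (Dlim x)); exists j.+1 => i ji.
  rewrite -/(quad _ _) quad_even_blocks; have := even_odd_blocks_le i x.
  by have := @sum_ge (fun l => d l.*2.+1 x) i j (fun l => d_ge0 _ x) ji; lra.
- apply: (seq_cvg_unique ip_norm (Dlim (L x))).
  have := seq_cvg_map lL Lc (Dlim x); congr seq_cvg.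
  apply/funext => m; rewrite /even_blocks.
  elim: m => [|m IH].
    rewrite !big_ord0 -[0 in LHS](scale0r (0 : H)).
    by rewrite (linear_applyZ lL) scale0r.
  by rewrite !big_ord_recr /= (linear_applyD lL) IH (linear_applyB lL) !EL.
Qed.

End Blocks.

(** Gliding hump.  When the quadratic forms of the class [C] can be raised
    again and again so as to capture most of the mass of [z x] for some [x] in
    each of the shrinking sets [X_ e], the sum of every other increment is a
    contraction whose quadratic form oscillates along the sets [X_ e]. *)
Lemma gliding_hump (C : set (H -> H)) (X_ : R -> set H) (z : H -> H) (kappa : R) :
  (forall e e', e <= e' -> X_ e `<=` X_ e') ->
  (forall B, C B -> positive_contraction ip B) -> C (fun=> 0) ->
  (forall B e, C B -> 0 < e -> exists x B', [/\ X_ e x, C B',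
     forall y, quad B y <= quad B' y,
     3 / 4 * n (z x) ^+ 2 <= quad B' (z x) - quad B (z x) &
     kappa <= n (z x) ^+ 2 <= 2 * kappa]) ->
  exists D, [/\ positive_contraction ip D,
    forall e, 0 < e -> exists x y, [/\ X_ e x, X_ e y &
      kappa / 4 <= quad D (z x) - quad D (z y)] &
    forall (L : H -> H) (c : R), linear L -> (forall x, n (L x) <= c * n x) ->
      (forall B x, C B -> B (L x) = L (B x)) -> forall x, D (L x) = L (D x)].
Proof.
move=> Xmono Ccontr C0 step.
have /choice[f fP] (q : nat * (H -> H)) : exists p : H * (H -> H), C q.2 ->
    [/\ X_ (q.1.+1%:R^-1) p.1, C p.2, forall y, quad q.2 y <= quad p.2 y,
     3 / 4 * n (z p.1) ^+ 2 <= quad p.2 (z p.1) - quad q.2 (z p.1) &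
     kappa <= n (z p.1) ^+ 2 <= 2 * kappa].
  have [Cq|nCq] := pselect (C q.2); last by exists (0, q.2).
  have i0 : 0 < q.1.+1%:R^-1 :> R by rewrite invr_gt0.
  by have [x [B' h]] := step _ _ Cq i0; exists (x, B').
pose E_ := fix E_ i := if i is j.+1 then (f (j, E_ j)).2 else (fun=> 0).
have CE i : C (E_ i) by elim: i => [|i IH] //=; case: (fP (i, E_ i) IH).
pose x_ i := (f (i, E_ i)).1.
have EP i := fP (i, E_ i) (CE i).
have [D [cD Deven Dodd Dcomm]] : exists D, [/\ positive_contraction ip D,
    forall j x, quad (E_ j.*2.+1) x - quad (E_ j.*2) x <= quad D x,
    forall j x, quad D x <= n x ^+ 2 - (quad (E_ j.*2.+2) x - quad (E_ j.*2.+1) x) &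
    forall (L : H -> H) (c : R), linear L -> (forall x, n (L x) <= c * n x) ->
    (forall i x, E_ i (L x) = L (E_ i x)) -> forall x, D (L x) = L (D x)].
  by apply: even_blocks_limit => // [i|i x]; [exact: Ccontr|case: (EP i)].
exists D; split=> // [e e0|L c lL Lc LC x]; last first.
  by apply: Dcomm lL Lc _ _ => i y; apply: LC.
have [m mP] := exists_small_inv e0.
exists (x_ m.*2), (x_ m.*2.+1).
have m2 : (m <= m.*2)%N by rewrite -addnn leq_addr.
have [X1 _ _ h1 /andP[h2 _]] := EP m.*2.
have [X2 _ _ h3 /andP[_ h4]] := EP m.*2.+1.
split; first by apply: Xmono X1; exact: mP.
  by apply: Xmono X2; apply: mP; exact: leqW.
have := Deven m (z (x_ m.*2)); have := Dodd m (z (x_ m.*2.+1)).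
rewrite /x_ /= in h1 h2 h3 h4 *.
by lra.
Qed.

End GlidingHump.

(** * Projections and powers of positive contractions *)

Section Contractions.
Variables (R : realType) (k : scalar_kind).
Local Notation K := (scalar_field R k).
Local Notation re := (@scalar_re R k).
Local Notation oR := (@scalar_of_real R k).
Variables (H : completeNormedModType K) (ip : {dot H for @scalar_conj R k}).
Hypothesis ip_norm : forall x : H, ip x x = `|x| ^+ 2.
Local Notation n := (form_norm ip).
Let hip := dot_semi_inner ip_norm.
Local Notation quad := (quad ip).

Lemma rank_one_linear (v : H) : linear (fun y => ip y v *: v).
Proof. by move=> a x y; rewrite (formDl hip) (formZl hip) scalerDl scalerA. Qed.

Lemma rank_one_symmetric (v : H) : symmetric_op ip (fun y => ip y v *: v).
Proof.
move=> x y; rewrite (formZl hip) (formZr hip) mulrC.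
by rewrite -(formC hip).
Qed.

Lemma quad_idempotent B x : symmetric_op ip B -> (forall y, B (B y) = B y) ->
  quad B x = n (B x) ^+ 2.
Proof. by move=> sB BB; rewrite /quad -{1}BB sB -(sqr_form_norm hip). Qed.

Lemma projection_contraction B : linear B -> symmetric_op ip B ->
  (forall y, B (B y) = B y) -> positive_contraction ip B.
Proof.
move=> lB sB BB; split=> // x; rewrite -/(quad B x) quad_idempotent // sqr_ge0 /=.
rewrite ler_pXn2r ?nnegrE ?form_norm_ge0 //.
have [->|Bx0] := eqVneq (n (B x)) 0; first exact: form_norm_ge0.
have B0 : 0 < n (B x) by rewrite lt0r Bx0 form_norm_ge0.
rewrite -(ler_pM2l B0) -expr2 -quad_idempotent //.
exact: (re_form_le hip).
Qed.

(** Enlarging a projection by the line of the part of [z] that it misses. *)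
Lemma projection_extend B z : linear B -> symmetric_op ip B ->
  (forall y, B (B y) = B y) -> n (B z) < n z ->
  exists v, let B' := fun y => B y + ip y v *: v in
  [/\ n v = 1, [/\ linear B', symmetric_op ip B' & forall y, B' (B' y) = B' y],
      forall y, quad B y <= quad B' y & quad B' z = n z ^+ 2].
Proof.
move=> lB sB BB Bz; pose w := z - B z.
have Bw : B w = 0 by rewrite /w (linear_applyB lB) BB subrr.
have w0 : n w != 0.
  apply/negP => /eqP w0; move: Bz.
  have := form_normD hip w (B z); rewrite w0 add0r subrK.
  by rewrite leNgt => /negP.
have w1 : 0 < n w by rewrite lt0r w0 form_norm_ge0.
pose v := oR (n w)^-1 *: w.
have Bv : B v = 0 by rewrite /v (linear_applyZ lB) Bw scaler0.
have v1 : n v = 1 by exact: (form_norm_normalize hip).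
have vv : ip v v = 1 by rewrite (form_self hip) v1 expr1n scalar_real1.
have quadE y : quad (fun y => B y + ip y v *: v) y = quad B y + sabs (ip y v) ^+ 2.
  rewrite /quad (formDl hip) scalar_reD (formZl hip) (formC hip y v).
  by rewrite scalar_mul_conj scalar_re_real.
exists v; split=> //; first split.
- move=> a x y; rewrite lB rank_one_linear scalerDr addrACA.
  by [].
- move=> x y; rewrite (formDl hip) (formDr hip) sB.
  by rewrite (rank_one_symmetric v x y).
- move=> y; rewrite (linear_applyD lB) BB (linear_applyZ lB) Bv scaler0 addr0.
  rewrite (formDl hip) (formZl hip) sB Bv vv mulr1.
  by rewrite (form0r hip) add0r.
- by move=> y; rewrite quadE lerDl sqr_ge0.
rewrite quadE.
have zw : ip z w = oR (n w ^+ 2).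
  rewrite -(form_self hip) {2}/w (formBl hip) sB Bw.
  by rewrite (form0r hip) subr0.
rewrite /v (formZr hip) scalar_conj_real sabsM zw !sabs_real.
rewrite ger0_norm ?invr_ge0 ?(ltW w1) // ger0_norm ?sqr_ge0 //.
have -> : (n w)^-1 * n w ^+ 2 = n w by rewrite expr2 mulKf.
rewrite /w (sqr_form_normB hip) (re_formC hip z) -/(quad B z).
by rewrite -(quad_idempotent z sB BB); ring.
Qed.

Section Powers.
Variables (G : H -> H) (cG : positive_contraction ip G).

Lemma iter_linear j : linear (iter j G).
Proof.
by elim: j => [|j IH] a x y //=; rewrite IH; case: cG => ->.
Qed.

Lemma iter_symmetric j : symmetric_op ip (iter j G).
Proof.
elim: j => [|j IH] x y //; rewrite iterS iterSr.
by case: cG => _ -> _; rewrite IH.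
Qed.

Lemma quad_iter_double i x : quad (iter i.*2 G) x = n (iter i G x) ^+ 2.
Proof.
by rewrite /quad -addnn iterD iter_symmetric -(sqr_form_norm hip).
Qed.

Lemma quad_iter_doubleS i x : quad (iter i.*2.+1 G) x = quad G (iter i G x).
Proof.
by rewrite /quad -addnn -addnS iterD iterS iter_symmetric.
Qed.

(** Even and odd powers are handled apart: the form of an even power is a
   squared norm, that of an odd power is the form of [G] at a smaller power. *)
Lemma quad_iter_ge0 j x : 0 <= quad (iter j G) x.
Proof.
rewrite -(odd_double_half j); case: (odd j); rewrite ?add0n ?add1n.
  by rewrite quad_iter_doubleS; case: cG => _ _ /(_ (iter j./2 G x)) /andP[].
by rewrite quad_iter_double sqr_ge0.
Qed.

Lemma quad_iterS_le j x : quad (iter j.+1 G) x <= quad (iter j G) x.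
Proof.
rewrite -(odd_double_half j); case: (odd j); rewrite ?add0n ?add1n.
  rewrite -doubleS quad_iter_double quad_iter_doubleS iterS.
  exact: (sqr_positive_contraction ip_norm).
rewrite quad_iter_double quad_iter_doubleS.
by case: cG => _ _ /(_ (iter j./2 G x)) /andP[].
Qed.

Lemma quad_iter_le i j x : (i <= j)%N -> quad (iter j G) x <= quad (iter i G) x.
Proof.
move/subnKC <-; elim: (j - i)%N => [|m IH]; first by rewrite addn0.
by rewrite addnS; apply: le_trans (quad_iterS_le _ _) IH.
Qed.

Lemma iter_contraction_le j x : n (iter j G x) <= n x.
Proof.
elim: j => [//|j IH]; rewrite iterS; apply: le_trans IH.
exact: (positive_contraction_le ip_norm).
Qed.

Lemma quad_sub_iter j x :
  quad (fun y => y - iter j G y) x = n x ^+ 2 - quad (iter j G) x.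
Proof. by rewrite /quad (formBl hip) scalar_reD scalar_reN -(sqr_form_norm hip). Qed.

Lemma sub_iter_contraction j : positive_contraction ip (fun y => y - iter j G y).
Proof.
split=> [a x y|x y|x].
- by rewrite iter_linear scalerBr opprD addrACA.
- by rewrite (formBl hip) (formBr hip) iter_symmetric.
rewrite -/(quad (fun y => y - iter j G y) x) quad_sub_iter subr_ge0.
rewrite lerBlDr lerDl quad_iter_ge0 andbT.
apply: le_trans (quad_iter_le _ (leq0n j)) _.
by rewrite /quad /= -(sqr_form_norm hip).
Qed.

Lemma iter_sub_le j x : n (x - iter j G x) <= j%:R * n (x - G x).
Proof.
elim: j => [|j IH]; first by rewrite subrr (form_norm0 hip) mul0r.
have -> : x - iter j.+1 G x = (x - iter j G x) + iter j G (x - G x).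
  by rewrite (linear_applyB (iter_linear j)) -iterSr addrA subrK.
apply: le_trans (form_normD hip _ _) _.
by rewrite -natr1 mulrDl mul1r lerD // iter_contraction_le.
Qed.

(** The terms [re (ip (iter j G (x - G x)) x)] telescope when summed over [j];
    as they decrease, [m] times the last one is below the sum. *)
Lemma iter_defect_le m x :
  (forall j, re (ip (iter j.+1 G (x - G x)) x) <= re (ip (iter j G (x - G x)) x)) ->
  m%:R * re (ip (iter m G (x - G x)) x) <= n x ^+ 2.
Proof.
move=> dec.
have dec' i j : (i <= j)%N ->
    re (ip (iter j G (x - G x)) x) <= re (ip (iter i G (x - G x)) x).
  move/subnKC <-; elim: (j - i)%N => [|l IH]; first by rewrite addn0.
  by rewrite addnS; apply: le_trans (dec _) IH.
suff h l : (l <= m)%N -> l%:R * re (ip (iter m G (x - G x)) x) <=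
    n x ^+ 2 - quad (iter l G) x.
  by apply: le_trans (h m (leqnn m)) _; rewrite lerBlDr lerDl quad_iter_ge0.
elim: l => [_|l IH lm].
  by rewrite mul0r /quad /= -(sqr_form_norm hip) subrr.
rewrite -natr1 mulrDl mul1r.
apply: le_trans (lerD (IH (ltnW lm)) (dec' _ _ (ltnW lm))) _.
rewrite (linear_applyB (iter_linear l)) (formBl hip) scalar_reD scalar_reN.
by rewrite -iterSr /quad; lra.
Qed.

End Powers.
End Contractions.

(** * Near-maximizing vectors cannot all escape *)

Section PositiveOperator.
Variables (R : realType) (k : scalar_kind).
Local Notation K := (scalar_field R k).
Local Notation re := (@scalar_re R k).
Local Notation oR := (@scalar_of_real R k).
Variables (H : completeNormedModType K) (ip : {dot H for @scalar_conj R k}).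
Hypothesis ip_norm : forall x : H, ip x x = `|x| ^+ 2.
Local Notation n := (form_norm ip).
Let hip := dot_semi_inner ip_norm.
Local Notation quad := (quad ip).
Variables A S : {linear H -> H}.
Hypothesis A_pos : positive_operator ip A.
Hypothesis S_sqrt : positive_sqrt ip A S.
Local Notation bA := (ipA ip A).
Local Notation nA := (form_norm bA).

Lemma ipA_semi_inner : semi_inner bA.
Proof.
case: A_pos => _ sA pA; split=> [a x y z|x y|x].
- by rewrite /ipA linearP (formDl hip) (formZl hip).
- by rewrite /ipA sA (formC hip).
- exact: scalar_ge0_re (pA x).
Qed.
Let hA := ipA_semi_inner.

Lemma sqrt_sym x y : ip (S x) y = ip x (S y).
Proof. by case: S_sqrt => -[_ h _] _. Qed.

Lemma sqrtK x : S (S x) = A x.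
Proof. by case: S_sqrt. Qed.

Lemma ipA_sqrt x y : bA x y = ip (S x) (S y).
Proof. by rewrite /ipA -sqrtK sqrt_sym. Qed.

Lemma form_norm_ipA x : nA x = n (S x).
Proof. by rewrite /form_norm ipA_sqrt. Qed.

Lemma sqrt_bounded : op_bounded n S.
Proof. by case: S_sqrt => -[]. Qed.

Lemma positive_bounded : op_bounded n A.
Proof. by case: A_pos. Qed.

Lemma sqrt_comm x : A (S x) = S (A x).
Proof. by rewrite -!sqrtK. Qed.

Variables (T : H -> H).
Hypothesis DT : bounded_ops nA T.
Hypothesis NT0 : op_norm nA T != 0.
Local Notation near := (near_max bA T).

Hypothesis cauchy_range : forall Q : H -> H, linear Q -> symmetric_op ip Q ->
  op_bounded n Q -> cauchy_at_max bA T (Q \o A).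
Hypothesis cauchy_commute : forall D : H -> H, positive_contraction ip D ->
  (forall x, D (S x) = S (D x)) -> cauchy_at_max bA T D.

Lemma rank_one_bounded v : op_bounded n (fun y => ip y v *: v).
Proof.
have v2 : 0 < n v ^+ 2 + 1 by rewrite ltr_wpDl ?sqr_ge0.
exists (n v ^+ 2 + 1) => // x; rewrite (form_normZ hip).
apply: le_trans (_ : n x * n v * n v <= _).
  by rewrite ler_wpM2r ?form_norm_ge0 // (form_cauchy_schwarz hip).
by have := form_norm_ge0 ip x; rewrite mulrDl mul1r -mulrA mulrC -expr2; lra.
Qed.

Lemma contraction_bounded B : positive_contraction ip B -> op_bounded n B.
Proof. by exists 1 => // x; rewrite mul1r (positive_contraction_le ip_norm). Qed.

Lemma cauchy_overlap v e : 0 < e -> exists2 d, 0 < d & forall x y,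
  near d x -> near d y -> sabs (bA x v) ^+ 2 - sabs (bA y v) ^+ 2 <= e.
Proof.
move=> e0; have := cauchy_range (rank_one_linear ip_norm v)
  (rank_one_symmetric ip_norm v) (rank_one_bounded v).
move=> /(_ e e0)[d d0 dP]; exists d => // x y xd yd.
have E z : re (bA (((fun y => ip y v *: v) \o A) z) z) = sabs (bA z v) ^+ 2.
  rewrite /= (formZl hA) (formC hA z v) -/(bA z v) scalar_mul_conj.
  by rewrite scalar_re_real.
by have := dP x y xd yd; rewrite !E.
Qed.

Section Escape.
Hypothesis overlap0 : forall (v : H) (e : R), 0 < e ->
  exists2 d, 0 < d & forall x, near d x -> sabs (bA x v) <= e.

(** If [A x] does not tend to zero, a hump gliding over finite rank projections
    contradicts the convergence for the operators [Q A]. *)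
Lemma no_mass_off_zero (kappa : R) : 0 < kappa ->
  ~ forall d, 0 < d -> exists2 x, near d x & kappa <= n (A x) ^+ 2.
Proof.
move=> kappa0 mass.
have id_bd : op_bounded n id by exists 1 => // x; rewrite mul1r.
have id_sym : symmetric_op ip id by [].
have id_lin : linear (@id H) by [].
have k40 : 0 < kappa / 4 by rewrite divr_gt0.
have [d1 d10 d1P] := cauchy_range id_lin id_sym id_bd k40.
have hE x : re (bA ((id \o A) x) x) = n (A x) ^+ 2.
  by rewrite /= /ipA; case: A_pos => _ -> _; rewrite -(sqr_form_norm hip).
have [x0 x0d x0k] := mass d1 d10.
(* By convergence [n (A x) ^+ 2] lies between [kap] and [2 * kap] from now on. *)
pose kap := n (A x0) ^+ 2 - kappa / 4.
have kap0 : 0 < kap by rewrite /kap; lra.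
have kapP x : near d1 x -> kap <= n (A x) ^+ 2 <= 2 * kap.
  move=> xd; have := d1P _ _ xd x0d; have := d1P _ _ x0d xd.
  by rewrite !hE /kap => h1 h2; apply/andP; split; lra.
(* Projections that do not see the near-maximizing vectors: each of them can
   be extended by the direction of some [A x], and still does not see them. *)
pose C : set (H -> H) := [set B | [/\ linear B, symmetric_op ip B,
  forall y, B (B y) = B y & forall e, 0 < e -> exists2 d, 0 < d &
    forall x, near d x -> n (B (A x)) <= e]].
have [||||D [cD osc _]] :=
    @gliding_hump R k H ip ip_norm C (fun e => near (Num.min d1 e)) A kap.
- move=> e e' ee'; apply: near_max_sub.
  by rewrite le_min ge_min lexx /= ge_min ee' orbT.
- by move=> B [lB sB BB _]; exact: projection_contraction.
- split=> // [a x y|x y|e e0]; first by rewrite scaler0 addr0.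
    by rewrite (form0l hip) (form0r hip).
  by exists 1 => // x _; rewrite (form_norm0 hip) ltW.
- move=> B e [lB sB BB B0] e0.
  have q0 : 0 < Num.sqrt kap / 2 by rewrite divr_gt0 ?sqrtr_gt0.
  have [d d0 dP] := B0 _ q0.
  have m0 : 0 < Num.min (Num.min d1 e) d by rewrite !lt_min d10 e0.
  have [x xm] := near_max_ex NT0 m0.
  have xd : near d x by apply: near_max_sub xm; rewrite ge_min lexx orbT.
  have xe : near (Num.min d1 e) x by apply: near_max_sub xm; rewrite ge_min lexx.
  have xd1 : near d1 x by apply: near_max_sub xe; rewrite ge_min lexx.
  have /andP[k1 k2] := kapP _ xd1.
  have Bx : n (B (A x)) ^+ 2 <= kap / 4.
    have -> : kap / 4 = (Num.sqrt kap / 2) ^+ 2.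
      by rewrite exprMn sqr_sqrtr ?(ltW kap0) // exprVn -natrX.
    by rewrite ler_pXn2r ?nnegrE ?form_norm_ge0 ?(ltW q0) // dP.
  have [|v [v1 [lB' sB' BB'] Bmono B'x]] :=
      projection_extend ip_norm (z := A x) lB sB BB.
    rewrite -(@ltr_pXn2r _ 2) ?nnegrE ?form_norm_ge0 //.
    by apply: le_lt_trans Bx _; lra.
  exists x, (fun y => B y + ip y v *: v); split=> //; last first.
  + by rewrite k1 k2.
  + rewrite B'x (quad_idempotent ip_norm _ sB BB).
    by lra.
  split=> // e1 e10; have e12 : 0 < e1 / 2 by rewrite divr_gt0.
  have [d2 d20 d2P] := B0 _ e12; have [d3 d30 d3P] := overlap0 v e12.
  exists (Num.min d2 d3); first by rewrite lt_min d20.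
  move=> y yd; apply: le_trans (form_normD hip _ _) _.
  have y2 : near d2 y by apply: near_max_sub yd; rewrite ge_min lexx.
  have y3 : near d3 y by apply: near_max_sub yd; rewrite ge_min lexx orbT.
  rewrite (form_normZ hip) v1 mulr1 -/(bA y v).
  by have := d2P _ y2; have := d3P _ y3; lra.
have [_ sD _] := cD; have [lD _ _] := cD.
have k8 : 0 < kap / 8 by rewrite divr_gt0.
have [d d0 dP] := cauchy_range lD sD (contraction_bounded cD) k8.
have [x [y [xd yd]]] := osc _ d0; apply/negP; rewrite -ltNge.
have xd' : near d x by apply: near_max_sub xd; rewrite ge_min lexx orbT.
have yd' : near d y by apply: near_max_sub yd; rewrite ge_min lexx orbT.
have := dP _ _ xd' yd'.
have E z : re (bA ((D \o A) z) z) = quad D (A z).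
  by rewrite /= /ipA /quad; case: A_pos => _ -> _.
by rewrite !E; lra.
Qed.

(** If [A x] tends to zero, the mass of [x] moves to the bottom of the spectrum
    of [A], and a hump gliding over the operators [1 - G ^ j], where
    [G = 1 - A / c], contradicts the convergence for the operators commuting
    with the square root of [A]. *)
Lemma mass_off_zero :
  ~ forall e, 0 < e -> exists2 d, 0 < d & forall x, near d x -> n (A x) <= e.
Proof.
move=> mass.
have [c c0 cA] := positive_bounded; have [cS cS0 SB] := sqrt_bounded.
pose G := fun y => y - oR c^-1 *: A y.
have ci0 : 0 < c^-1 by rewrite invr_gt0.
have cG : positive_contraction ip G.
  case: (A_pos) => _ sA pA; split=> [a x y|x y|x].
  - rewrite /G linearP scalerDr scalerBr !scalerA (mulrC (oR _)) opprD addrACA.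
    by [].
  - rewrite /G (formBl hip) (formBr hip) (formZl hip) (formZr hip) sA.
    by rewrite scalar_conj_real.
  rewrite /G (formBl hip) scalar_reD scalar_reN (formZl hip) scalar_re_realM.
  rewrite -(sqr_form_norm hip) subr_ge0.
  have h0 : 0 <= re (ip (A x) x) by exact: scalar_ge0_re (pA x).
  have h1 : re (ip (A x) x) <= c * n x ^+ 2.
    apply: le_trans (re_form_le hip _ _) _; rewrite expr2 mulrA.
    by rewrite ler_wpM2r ?form_norm_ge0.
  apply/andP; split; first by rewrite mulrC ler_pdivrMr // mulrC.
  by rewrite gerBl mulr_ge0 // ltW.
have GS j x : iter j G (S x) = S (iter j G x).
  elim: j x => [//|j IH] x; rewrite !iterSr -IH; congr (iter j G _).
  by rewrite /G sqrt_comm linearB [S (_ *: _)]linearZ_LR.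
have GE x : x - G x = oR c^-1 *: A x by rewrite /G opprB addrCA subrr addr0.
have quadS j x : re (ip (iter j G (x - G x)) x) = c^-1 * quad (iter j G) (S x).
  rewrite GE (linear_applyZ (iter_linear cG j)) (formZl hip) scalar_re_realM.
  by rewrite -sqrtK GS sqrt_sym.
have quad_small x (e : R) : 0 < e -> exists m : nat, forall j, (m <= j)%N ->
    quad (iter j G) (S x) <= e.
  move=> e0; exists (Num.bound (c * n x ^+ 2 / e)).+1 => j mj.
  have j0 : 0 < j%:R :> R by rewrite ltr0n (leq_trans _ mj).
  have := @iter_defect_le _ _ _ _ ip_norm _ cG j x.
  rewrite quadS => h.
  have {}h : j%:R * (c^-1 * quad (iter j G) (S x)) <= n x ^+ 2.
    apply: h => i; rewrite !quadS ler_pM2l //.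
    exact: (quad_iterS_le ip_norm cG).
  have h2 : c * n x ^+ 2 <= e * j%:R.
    rewrite -ler_pdivrMl // mulrC.
    have b0 : 0 <= c * n x ^+ 2 / e.
      exact: divr_ge0 (mulr_ge0 (ltW c0) (sqr_ge0 _)) (ltW e0).
    by apply: le_trans (ltW (archi_boundP b0)) _; rewrite ler_nat ltnW.
  have h3 : quad (iter j G) (S x) * j%:R <= c * n x ^+ 2.
    move: h; rewrite mulrCA -(ler_pM2l c0) mulVKf ?gt_eqF // mulrC.
    by [].
  by rewrite -(ler_pM2r j0); apply: le_trans h3 h2.
pose C : set (H -> H) := [set B | exists j, B = (fun y => y - iter j G y)].
have [||||D [cD osc Dcomm]] := @gliding_hump R k H ip ip_norm C near S 1.
- by move=> e e' ee'; apply: near_max_sub.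
- by move=> B [j ->]; exact: sub_iter_contraction.
- by exists 0%N; apply/funext => y; rewrite subrr.
- move=> B e [j ->] e0.
  pose q := j%:R * (c^-1 * cS) + 1.
  have q0 : 0 < q by rewrite ltr_wpDl // mulr_ge0 ?mulr_ge0 ?ler0n ?ltW.
  have e8 : 0 < 8^-1 / q by rewrite divr_gt0 ?invr_gt0.
  have [d d0 dP] := mass _ e8.
  have m0 : 0 < Num.min e d by rewrite lt_min e0.
  have [x xm] := near_max_ex NT0 m0.
  have xe : near e x by apply: near_max_sub xm; rewrite ge_min lexx.
  have xd : near d x by apply: near_max_sub xm; rewrite ge_min lexx orbT.
  have x1 : n (S x) = 1 by rewrite -form_norm_ipA; case: xe.
  have i8 : 0 < 8^-1 :> R by rewrite invr_gt0.
  have [m mP] := quad_small x _ i8.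
  exists x, (fun y => y - iter (maxn j m) G y); split=> //.
  + by exists (maxn j m).
  + move=> y; rewrite !(quad_sub_iter ip_norm) lerB //.
    by rewrite (quad_iter_le ip_norm cG) // leq_maxl.
  + rewrite !(quad_sub_iter ip_norm) x1.
    have h1 := mP _ (leq_maxr j m).
    have h2 : quad (fun y => y - iter j G y) (S x) <= 8^-1.
      apply: le_trans (re_form_le hip _ _) _; rewrite x1 mulr1.
      apply: le_trans (iter_sub_le ip_norm cG j (S x)) _.
      rewrite GE (form_normZr hip) ?(ltW ci0) // sqrt_comm.
      apply: le_trans (_ : q * n (A x) <= _); last first.
        by have := dP x xd; rewrite ler_pdivlMr // mulrC.
      rewrite /q mulrDl -!mulrA ler_wpDr ?mul1r ?form_norm_ge0 //.
      by rewrite ler_wpM2l ?ler0n // ler_pM2l.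
    by move: h2; rewrite (quad_sub_iter ip_norm) x1 expr1n; lra.
  + by rewrite x1 expr1n; apply/andP; split; lra.
have DS x : D (S x) = S (D x).
  apply: (Dcomm S cS) => // [a u v|B y [j ->]]; first exact: linearP.
  by rewrite GS linearB.
have i8 : 0 < 8^-1 :> R by rewrite invr_gt0.
have [d d0 dP] := cauchy_commute cD DS i8.
have [x [y [xd yd]]] := osc _ d0; apply/negP; rewrite -ltNge.
have E z : re (bA (D z) z) = quad D (S z) by rewrite ipA_sqrt -DS.
by have := dP _ _ xd yd; rewrite !E; lra.
Qed.

End Escape.

(** Either some fixed vector sees the near-maximizing ones, or they escape, and
    the two ways of escaping are excluded. *)
Lemma positive_aligned_maximizers : aligned_maximizers bA T.
Proof.
have [[v [e e0 ve]]|nov] := pselect (exists v, exists2 e, 0 < e &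
    forall d, 0 < d -> exists2 x, near d x & e <= sabs (bA x v) ^+ 2).
  have e2 : 0 < e / 2 by rewrite divr_gt0.
  have [d d0 dP] := cauchy_overlap v e2.
  have [x0 x0d x0e] := ve d d0.
  apply: (aligned_of_overlap hA DT NT0 (v := v) e2 d0) => [x xd|e1 e10].
    by have := dP _ _ x0d xd; lra.
  exact: cauchy_overlap.
have overlap0 v e : 0 < e ->
    exists2 d, 0 < d & forall x, near d x -> sabs (bA x v) <= e.
  move=> e0; apply: contrapT => nd; apply: nov; exists v, (e ^+ 2).
    by rewrite exprn_gt0.
  move=> d d0; apply: contrapT => nx; apply: nd; exists d => // x xd.
  rewrite leNgt; apply/negP => ex; apply: nx; exists x => //.
  by rewrite ler_pXn2r ?nnegrE ?sabs_ge0 // ltW.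
exfalso; apply: (mass_off_zero) => e e0; apply: contrapT => nd.
have e2 : 0 < e ^+ 2 by rewrite exprn_gt0.
apply: (no_mass_off_zero overlap0 e2) => d d0; apply: contrapT => nx.
apply: nd; exists d => // x xd; rewrite leNgt; apply/negP => ex; apply: nx.
by exists x => //; rewrite ler_pXn2r ?nnegrE ?form_norm_ge0 // ltW.
Qed.

End PositiveOperator.

(** * The space [R(A^(1/2))] *)

Section RangeSpaceTransfer.
Variables (R : realType) (k : scalar_kind).
Local Notation K := (scalar_field R k).
Local Notation oR := (@scalar_of_real R k).
Variables (H : completeNormedModType K) (ip : {dot H for @scalar_conj R k}).
Hypothesis ip_norm : forall x : H, ip x x = `|x| ^+ 2.
Local Notation n := (form_norm ip).
Let hip := dot_semi_inner ip_norm.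
Variables A S : {linear H -> H}.
Hypothesis A_pos : positive_operator ip A.
Hypothesis S_sqrt : positive_sqrt ip A S.
Variable P : H -> H.
Hypothesis P_proj : orthogonal_projection ip (closure (range A)) P.
Local Notation bA := (ipA ip A).
Local Notation nA := (form_norm bA).
Local Notation Y := (range_space S).
Local Notation bY := (@range_ip R k H ip S P).
Local Notation nY := (form_norm bY).
Let hA := ipA_semi_inner ip_norm A_pos.
Implicit Types (u v : Y) (x y w : H).

(** The isometry into the closure of the range of [A] that inverts [S]. *)
Definition range_lift u : H := P (xget 0 [set x | S x = rs_val u]).
Local Notation J := range_lift.

Lemma closure_rangeP y e : closure (range A) y -> 0 < e ->
  exists x, n (y - A x) < e.
Proof.
move=> cy e0; have e1 : 0 < oR e by rewrite scalar_real_gt0.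
have [_ [[x _ <-]]] := cy _ (nbhsx_ballx y _ e1).
rewrite -ball_normE /= (dot_normE ip_norm) -subr_gt0 -scalar_realN -scalar_realD.
by rewrite scalar_real_gt0 subr_gt0; exists x.
Qed.

Lemma sqrt_ker x : A x = 0 -> S x = 0.
Proof.
move=> Ax; apply: (form_norm_eq0 ip_norm); apply/eqP; rewrite -sqrf_eq0.
rewrite (sqr_form_norm hip) (sqrt_sym S_sqrt) (sqrtK S_sqrt) Ax.
by rewrite (form0r hip) scalar_re0.
Qed.

(** [P] only removes from the chosen preimage a vector killed by [S]. *)
Lemma range_lift_val u : S (J u) = rs_val u.
Proof.
have uP : S (xget 0 [set x | S x = rs_val u]) = rs_val u.
  case: u => y yS /=; move: (yS); rewrite /in_range unfold_in inE => -[x _ xy].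
  by apply: (@xgetPex _ 0 [set x | S x = y]); exists x.
rewrite /J -[RHS]uP; set x := xget _ _.
have [_ xP] := P_proj x; apply/eqP; rewrite eq_sym -subr_eq0 -linearB; apply/eqP.
have APx : A (x - P x) = 0.
  apply: (form_norm_eq0 ip_norm); apply/eqP; rewrite -sqrf_eq0.
  rewrite (sqr_form_norm hip); case: (A_pos) => _ -> _.
  by rewrite xP ?scalar_re0 //; apply: subset_closure; exists (A (x - P x)).
exact: sqrt_ker.
Qed.

Lemma range_lift_orth u w : S w = 0 -> ip (J u) w = 0.
Proof.
move=> Sw; have [cJ _] := P_proj (xget 0 [set x | S x = rs_val u]).
apply: sabs_eq0; apply/eqP; rewrite eq_le sabs_ge0 andbT.
apply/ler_addgt0Pr => e e0; rewrite add0r.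
have c0 : 0 < n w + 1 by rewrite ltr_wpDl ?form_norm_ge0.
have [x xJ] := closure_rangeP cJ (divr_gt0 e0 c0).
have -> : ip (J u) w = ip (J u - A x) w.
  rewrite (formBl hip); case: (A_pos) => _ -> _.
  by rewrite -(sqrtK S_sqrt) Sw linear0 (form0r hip) subr0.
apply: le_trans (form_cauchy_schwarz hip _ _) _.
apply: le_trans (_ : n (J u - A x) * (n w + 1) <= _).
  by rewrite ler_wpM2l ?form_norm_ge0 // lerDl.
by rewrite -ler_pdivlMr // ltW.
Qed.

(** [S] is injective on the orthogonal complement of its kernel, which gives
    the linearity of [J] whatever preimages are chosen. *)
Lemma range_liftE u y : S y = rs_val u ->
  (forall w, S w = 0 -> ip y w = 0) -> y = J u.
Proof.
move=> Sy yw; apply/eqP; rewrite -subr_eq0; apply/eqP.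
apply: (form_norm_eq0 ip_norm); apply/eqP; rewrite -sqrf_eq0.
have SJ : S (y - J u) = 0 by rewrite linearB range_lift_val Sy subrr.
rewrite (sqr_form_norm hip) (formBl hip) yw // range_lift_orth //.
by rewrite subrr scalar_re0.
Qed.

Lemma range_lift_linear : linear J.
Proof.
move=> a u v; symmetry; apply: range_liftE; first by rewrite linearP !range_lift_val.
by move=> w Sw; rewrite (formDl hip) (formZl hip) !range_lift_orth // mulr0 addr0.
Qed.

Lemma range_ipE u v : bY u v = ip (J u) (J v).
Proof. by []. Qed.

Lemma range_normE u : nY u = n (J u).
Proof. by []. Qed.

Lemma range_ip_semi_inner : semi_inner bY.
Proof.
split=> [a u v w|u v|u]; rewrite !range_ipE.
- by rewrite range_lift_linear (formDl hip) (formZl hip).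
- exact: (formC hip).
- by case: hip.
Qed.
Let hY := range_ip_semi_inner.

Lemma to_range_subproof y (h : exists x, S x = y) : y \in in_range S.
Proof. by rewrite unfold_in /in_range inE; case: h => x <-; exists x. Qed.

Definition to_range y (h : exists x, S x = y) : Y := RangeSpace (to_range_subproof h).

Definition range_inj x : Y := to_range (ex_intro _ (S x) (sqrtK S_sqrt x)).
Local Notation iota := range_inj.

Lemma range_lift_inj x : J (iota x) = S x.
Proof.
symmetry; apply: range_liftE; first by rewrite (sqrtK S_sqrt).
by move=> w Sw; rewrite (sqrt_sym S_sqrt) Sw (form0r hip).
Qed.

Lemma range_ip_inj x y : bY (iota x) (iota y) = bA x y.
Proof. by rewrite range_ipE !range_lift_inj (ipA_sqrt S_sqrt). Qed.

Lemma range_norm_inj x : nY (iota x) = nA x.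
Proof. by rewrite range_normE range_lift_inj (form_norm_ipA S_sqrt). Qed.

Lemma range_inj_dense u e : 0 < e -> exists x, nY (u - iota x) <= e.
Proof.
move=> e0; have [cJ _] := P_proj (xget 0 [set x | S x = rs_val u]).
have [x xJ] := closure_rangeP cJ e0; exists (S x).
rewrite range_normE (linear_applyB range_lift_linear) range_lift_inj.
by rewrite (sqrtK S_sqrt) ltW.
Qed.

Variables (T : H -> H) (Tt : Y -> Y).
Hypothesis DT : bounded_ops nA T.
Hypothesis DTt : bounded_ops nY Tt.
Hypothesis Tt_inj : forall x, Tt (iota x) = iota (T x).
Hypothesis NT0 : op_norm nA T != 0.

(** The image of [iota] is dense. *)
Lemma op_norm_range : op_norm nY Tt = op_norm nA T.
Proof.
apply/eqP; rewrite eq_le; apply/andP; split; apply: op_norm_lub.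
- exact: op_norm_ge0.
- move=> u u1; apply/ler_addgt0Pr => e e0.
  set M := op_norm nA T; set N := op_norm nY Tt.
  have c0 : 0 < N + M + 1 by rewrite ltr_wpDl // addr_ge0 ?op_norm_ge0.
  have [x xu] := range_inj_dense u (divr_gt0 e0 c0).
  have h1 : nY (Tt u) <= nY (Tt (u - iota x)) + nY (Tt (iota x)).
    have := form_normD hY (Tt (u - iota x)) (Tt (iota x)).
    by rewrite -(linear_applyD DTt.1) subrK.
  have h2 : nY (Tt (u - iota x)) <= N * nY (u - iota x).
    exact: (op_norm_le hY _ DTt.1 DTt.2).
  have h3 : nY (Tt (iota x)) <= M * nY (iota x).
    by rewrite Tt_inj !range_norm_inj (op_norm_le hA _ DT.1 DT.2).
  have h4 : nY (iota x) <= 1 + nY (u - iota x).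
    have := form_normD hY (iota x - u) u; rewrite subrK => h.
    by apply: le_trans h _; rewrite (form_normBC hY) addrC -u1.
  have N0 : 0 <= N by exact: op_norm_ge0.
  have M0 : 0 <= M by exact: op_norm_ge0.
  have h5 : M * nY (iota x) <= M * (1 + nY (u - iota x)) by rewrite ler_wpM2l.
  have h6 : nY (u - iota x) * (N + M + 1) <= e by rewrite -ler_pdivlMr.
  have h7 : 0 <= nY (u - iota x) by exact: form_norm_ge0.
  by lra.
- exact: op_norm_ge0.
move=> x x1; rewrite -range_norm_inj -Tt_inj.
have := op_norm_le hY (iota x) DTt.1 DTt.2.
by rewrite [nY (iota x)]range_norm_inj x1 mulr1.
Qed.

Lemma near_max_inj d x : near_max bA T d x -> near_max bY Tt d (iota x).
Proof.
move=> [x1 xd]; split; first by rewrite range_norm_inj.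
by rewrite op_norm_range Tt_inj range_norm_inj.
Qed.

Lemma cauchy_at_max_inj (U : H -> H) (V : Y -> Y) :
  (forall x, V (iota x) = iota (U x)) -> cauchy_at_max bY Tt V -> cauchy_at_max bA T U.
Proof.
move=> VU VC e e0; have [d d0 dP] := VC e e0; exists d => // x y xd yd.
by have := dP _ _ (near_max_inj xd) (near_max_inj yd); rewrite !VU !range_ip_inj.
Qed.

(** Density again: the approximating vector is rescaled to be a unit vector,
    which costs as much as the approximation itself. *)
Lemma near_max_range_approx d e : 0 < d -> 0 < e -> exists2 d', 0 < d' &
  forall u, near_max bY Tt d' u ->
    exists2 x, near_max bA T d x & nY (u - iota x) <= e.
Proof.
move=> d0 e0; have M0 := op_norm_gt0 NT0; set M := op_norm nA T in M0.
pose d1 := Num.min d M.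
have d10 : 0 < d1 by rewrite lt_min d0.
have d1M : d1 <= M by rewrite ge_min lexx orbT.
have c0 : 0 < d1 / (4 * M) by rewrite divr_gt0 ?mulr_gt0.
have e2 : 0 < e / 2 by rewrite divr_gt0.
pose t := Num.min (e / 2) (Num.min 2^-1 (d1 / (4 * M))).
have t0 : 0 < t by rewrite !lt_min e2 c0 invr_gt0 ltr0n.
have te : t <= e / 2 by rewrite ge_min lexx.
have t2 : t <= 2^-1 by rewrite !ge_min lexx !orbT.
have tM : t * (4 * M) <= d1.
  by rewrite -ler_pdivlMr ?mulr_gt0 // !ge_min lexx !orbT.
exists (d1 / 2); first by rewrite divr_gt0.
move=> u [u1 ud]; rewrite op_norm_range -/M in ud.
have [x xu] := range_inj_dense u t0.
have u1' : nY u = 1 by [].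
have p1 : nY (iota x) <= 1 + t.
  have := form_norm_triangle hY (iota x) u.
  by rewrite u1' (form_normBC hY); lra.
have p2 : 1 - t <= nY (iota x).
  have := form_norm_triangle hY u (iota x).
  by rewrite u1'; lra.
rewrite range_norm_inj in p1 p2; set p := nA x in p1 p2.
have p0 : 0 < p by lra.
have Tx : M - d1 / 2 - M * t < nA (T x).
  have := form_norm_triangle hY (Tt u) (Tt (iota x)).
  rewrite -(linear_applyB DTt.1) Tt_inj range_norm_inj => h.
  have := op_norm_le hY (u - iota x) DTt.1 DTt.2.
  rewrite op_norm_range -/M => h'.
  have : M * nY (u - iota x) <= M * t by rewrite ler_pM2l.
  by lra.
exists (oR p^-1 *: x).
  apply: (near_max_sub (d := d1)); first by rewrite ge_min lexx.
  split; first by apply: (form_norm_normalize hA); rewrite gt_eqF.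
  rewrite (linear_applyZ DT.1) (form_normZr hA) ?invr_ge0 ?(ltW p0) //.
  rewrite mulrC ltr_pdivlMr // -/M.
  apply: le_lt_trans Tx.
  have h1 : (M - d1) * p <= (M - d1) * (1 + t) by rewrite ler_wpM2l ?subr_ge0.
  have h2 : 0 <= d1 * t by rewrite mulr_ge0 ?ltW.
  by lra.
have -> : u - iota (oR p^-1 *: x) = (u - iota x) + (iota x - iota (oR p^-1 *: x)).
  by rewrite addrA subrK.
apply: le_trans (form_normD hY _ _) _.
have -> : nY (iota x - iota (oR p^-1 *: x)) = `|p - 1|.
  have -> : iota x - iota (oR p^-1 *: x) = oR (1 - p^-1) *: iota x.
    apply: val_inj; rewrite /= linearZ_LR scalar_realD scalar_realN scalar_real1.
    by rewrite scalerBl scale1r.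
  rewrite (form_normZ hY) sabs_real range_norm_inj.
  rewrite -/p -[X in _ * X](gtr0_norm p0) -normrM mulrBl mul1r mulVf //.
  by rewrite gt_eqF.
have : `|p - 1| <= t by rewrite ler_norml; apply/andP; split; lra.
by lra.
Qed.

Lemma aligned_maximizers_inj : aligned_maximizers bA T -> aligned_maximizers bY Tt.
Proof.
move=> al e e0; have e2 : 0 < e / 2 by rewrite divr_gt0.
have e4 : 0 < e / 4 by rewrite divr_gt0.
have [d d0 dP] := al _ e2; have [d' d'0 d'P] := near_max_range_approx d0 e4.
exists d' => // u v ud vd; have [x xd ux] := d'P _ ud; have [y yd vy] := d'P _ vd.
have := dP _ _ xd yd; rewrite -range_ip_inj.
have -> : bY (iota x) (iota y) =
    bY u v - (bY (u - iota x) v + bY (iota x) (v - iota y)).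
  by rewrite (formBl hY) (formBr hY); ring.
have := sabsD (bY u v) (- (bY (u - iota x) v + bY (iota x) (v - iota y))).
rewrite sabsN.
have := sabsD (bY (u - iota x) v) (bY (iota x) (v - iota y)).
have := form_cauchy_schwarz hY (u - iota x) v.
have := form_cauchy_schwarz hY (iota x) (v - iota y).
have x1 : form_norm bY (iota x) = 1 by case: (near_max_inj xd).
have v1 : form_norm bY v = 1 by case: vd.
rewrite x1 v1 mulr1 mul1r.
by lra.
Qed.

(** The lift sends [u] to [A (Q u)]. *)
Lemma lift_range_op (Q : H -> H) : linear Q -> op_bounded n Q ->
  exists2 V : Y -> Y, bounded_ops nY V & forall x, V (iota x) = iota (Q (A x)).
Proof.
move=> lQ [c c0 Qc].
pose V u := range_inj (Q (rs_val u)).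
exists V => [|x]; last by apply: val_inj.
have JV u : J (V u) = S (Q (S (J u))) by rewrite range_lift_inj range_lift_val.
split=> [a u v|].
  by apply: val_inj; rewrite /= lQ linearP.
have [cS cS0 Sc] := sqrt_bounded S_sqrt.
exists (cS * (c * cS)) => [|u]; first by rewrite !mulr_gt0.
rewrite !range_normE JV; apply: le_trans (Sc _) _; rewrite -!mulrA ler_pM2l //.
by apply: le_trans (Qc _) _; rewrite ler_pM2l.
Qed.

(** [D] commutes with [S], so it preserves the range of [S], and its lift is
    conjugated to [D] by the isometry [J]. *)
Lemma lift_commuting_op (D : H -> H) : positive_contraction ip D ->
  (forall x, D (S x) = S (D x)) ->
  exists2 V : Y -> Y, bounded_ops nY V & forall x, V (iota x) = iota (D x).
Proof.
move=> cD DS; have [lD sD _] := cD.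
have VP u : exists x, S x = D (rs_val u).
  by exists (D (J u)); rewrite -DS range_lift_val.
pose V u := to_range (VP u).
exists V => [|x]; last by apply: val_inj; rewrite /= -!(sqrtK S_sqrt) !DS.
have JV u : J (V u) = D (J u).
  symmetry; apply: range_liftE; first by rewrite -DS range_lift_val.
  move=> w Sw; rewrite sD range_lift_orth // -DS Sw.
  by have := linear_applyZ lD 0 0; rewrite !scale0r.
split=> [a u v|]; first by apply: val_inj; rewrite /= lD.
by exists 1 => // u; rewrite mul1r !range_normE JV (positive_contraction_le ip_norm).
Qed.

End RangeSpaceTransfer.

(** * The equivalence *)

Section Main.
Variables (R : realType) (k : scalar_kind).
Local Notation K := (scalar_field R k).
Variables (H : completeNormedModType K) (ip : {dot H for @scalar_conj R k}).
Hypothesis ip_norm : forall x : H, ip x x = `|x| ^+ 2.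
Local Notation n := (form_norm ip).
Let hip := dot_semi_inner ip_norm.
Variables A S : {linear H -> H}.
Hypothesis A_pos : positive_operator ip A.
Hypothesis S_sqrt : positive_sqrt ip A S.
Local Notation bA := (ipA ip A).
Local Notation nA := (form_norm bA).
Let hA := ipA_semi_inner ip_norm A_pos.

Lemma linear_packed (U : H -> H) : linear U -> exists F : {linear H -> H}, U = F.
Proof.
move=> lU; pose mixin := GRing.isLinear.Build K H H *:%R U lU.
by exists (HB.pack_for {linear H -> H} U mixin).
Qed.

Lemma range_op_bounded (Q : H -> H) : linear Q -> op_bounded n Q ->
  bounded_ops n (Q \o A) /\ bounded_ops nA (Q \o A).
Proof.
move=> lQ bQ; have lQA : linear (Q \o A) by move=> a x y /=; rewrite linearP lQ.
have [c c0 Qc] := bQ; have [cS cS0 Sc] := sqrt_bounded S_sqrt.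
have [cA cA0 Ac] := positive_bounded A_pos.
split; split=> //.
  exists (c * cA) => [|x /=]; first by rewrite mulr_gt0.
  by apply: le_trans (Qc _) _; rewrite -mulrA ler_pM2l.
exists (cS * (c * cS)) => [|x /=]; first by rewrite !mulr_gt0.
rewrite !(form_norm_ipA S_sqrt) -(sqrtK S_sqrt x).
apply: le_trans (Sc _) _; rewrite -!mulrA ler_pM2l //.
by apply: le_trans (Qc _) _; rewrite ler_pM2l.
Qed.

Lemma commuting_op_bounded (D : H -> H) : positive_contraction ip D ->
  (forall x, D (S x) = S (D x)) -> bounded_ops n D /\ bounded_ops nA D.
Proof.
move=> cD DS; have [lD _ _] := cD; split; split=> //.
  exact: (contraction_bounded ip_norm).
exists 1 => // x; rewrite mul1r !(form_norm_ipA S_sqrt) -DS.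
exact: (positive_contraction_le ip_norm).
Qed.

End Main.

Unset Implicit Arguments.
Set Strict Implicit.
Set Printing Implicit Defensive.

Theorem theorem2p16 (R : realType) (k : scalar_kind)
  (H : completeNormedModType (scalar_field R k)) (ip : {dot H for (@scalar_conj R k)})
  (ip_norm : forall x : H, ip x x = `|x| ^+ 2)
  (A : {linear H -> H}) (A_pos : positive_operator ip A)
  (A_neq0 : exists x, A x <> 0)
  (A12 : {linear H -> H}) (A12_sqrt : positive_sqrt ip A A12)
  (P : H -> H) (P_proj : orthogonal_projection ip (closure (range A)) P)
  (T : {linear H -> H}) (T_bounded : A_bounded ip A T)
  (T_neq0 : op_normA ip A T <> 0)
  (Tt : {linear range_space A12 -> range_space A12})
  (Tt_bounded : op_bounded (@range_norm R k H ip A12 P) Tt)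
  (Tt_A : forall (u : range_space A12) (x : H),
     rs_val u = A x -> rs_val (Tt u) = A (T x)) :
  A_smooth ip A T <->
  smooth_point (bounded_ops (@range_norm R k H ip A12 P))
    (op_norm (@range_norm R k H ip A12 P)) Tt.
Proof.
have hip := dot_semi_inner ip_norm.
have hA := ipA_semi_inner ip_norm A_pos.
have hY := range_ip_semi_inner ip_norm A_pos A12_sqrt P_proj.
have DnT : bounded_ops (form_norm ip) T by split; [exact: linearP|case: T_bounded].
have DT : bounded_ops (form_norm (ipA ip A)) T.
  by split; [exact: linearP|case: T_bounded].
have DTt : bounded_ops (form_norm (@range_ip R k H ip A12 P)) Tt.
  by split; [exact: linearP|].
have NT0 : op_norm (form_norm (ipA ip A)) T != 0 by apply/eqP.
pose iota := range_inj A12_sqrt.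
have Tt_iota x : Tt (iota x) = iota (T x) by apply: val_inj; exact: Tt_A.
have NTt : op_norm (form_norm (@range_ip R k H ip A12 P)) Tt != 0.
  by rewrite (op_norm_range ip_norm A_pos P_proj DT DTt Tt_iota).
split=> [[_ _ additive]|smooth].
  apply: (aligned_smooth hY DTt NTt).
  apply: (aligned_maximizers_inj ip_norm A_pos P_proj DT DTt Tt_iota NT0).
  (* The hypothesis concerns packed linear maps bounded for both norms. *)
  have cauchy U : bounded_ops (form_norm ip) U ->
      bounded_ops (form_norm (ipA ip A)) U -> cauchy_at_max (ipA ip A) T U.
    move=> DnU DU; apply: (additive_cauchy_at_max hA DT NT0 DU) => c1 c2.
    pose V1 := - c1 *: (T : H -> H) + (T \o U).
    pose V2 := c2 *: (T : H -> H) - (T \o U).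
    have -> : (T \o U) - c1 *: (T : H -> H) = V1 by rewrite addrC -scaleNr.
    rewrite -/V2 => T1 T2.
    have DnTU := bounded_ops_comp DnT DnU; have DTU := bounded_ops_comp DT DU.
    have [lV1 bV1] := bounded_opsP hA (- c1) DT DTU.
    have [_ nV1] := bounded_opsP hip (- c1) DnT DnTU.
    have [lV2 bV2] := bounded_opsP hA c2 DT (bounded_opsZ hA (-1) DTU).
    have [_ nV2] := bounded_opsP hip c2 DnT (bounded_opsZ hip (-1) DnTU).
    rewrite scaleN1r in lV2 bV2 nV2.
    have [F1 F1E] := linear_packed lV1; have [F2 F2E] := linear_packed lV2.
    have A1 : A_bounded ip A F1 by rewrite /A_bounded -F1E.
    have A2 : A_bounded ip A F2 by rewrite /A_bounded -F2E.
    by have := additive F1 F2 A1 A2; rewrite -F1E -F2E; apply.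
  apply: (positive_aligned_maximizers ip_norm A_pos A12_sqrt DT NT0).
    move=> Q lQ _ bQ; apply: cauchy.
      by have [] := range_op_bounded A_pos A12_sqrt lQ bQ.
    by have [] := range_op_bounded A_pos A12_sqrt lQ bQ.
  move=> D cD DS; apply: cauchy.
    by have [] := commuting_op_bounded ip_norm A12_sqrt cD DS.
  by have [] := commuting_op_bounded ip_norm A12_sqrt cD DS.
have cauchyY V : bounded_ops (form_norm (@range_ip R k H ip A12 P)) V ->
    cauchy_at_max (@range_ip R k H ip A12 P) Tt V.
  exact: (smooth_cauchy_at_max hY DTt NTt).
have al : aligned_maximizers (ipA ip A) T.
  apply: (positive_aligned_maximizers ip_norm A_pos A12_sqrt DT NT0).
    move=> Q lQ _ bQ.
    have [V DV VE] := lift_range_op ip_norm A_pos A12_sqrt P_proj lQ bQ.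
    exact: (cauchy_at_max_inj ip_norm A_pos P_proj DT DTt Tt_iota VE (cauchyY _ DV)).
  move=> D cD DS.
  have [V DV VE] := lift_commuting_op ip_norm A_pos A12_sqrt P_proj cD DS.
  exact: (cauchy_at_max_inj ip_norm A_pos P_proj DT DTt Tt_iota VE (cauchyY _ DV)).
split=> // S1 S2 [_ b1] [_ b2] T1 T2.
by apply: (aligned_bj_additive hA DT NT0 al _ _ T1 T2); split=> //; exact: linearP.
Qed.
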